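(* Let $G$ be a discrete group, and let $\mathcal{M}$ be the space of (surjective) $G$-equivariant morphisms between $\mathbb{R}$-trees with isometric $G$-action, with its equivariant Gromov-Hausdorff topology. The maps $\Phi,\Psi:\mathcal{M}\times[0,\infty]\to\mathcal{M}$, $\Phi(f,t)=\varphi_t$, $\Psi(f,t)=\psi_t$, are continuous.
   Context: An $\mathbb{R}$-tree is a connected metric space whose distance satisfies the $0$-hyperbolicity inequality $d(x,y)+d(z,t)\le\max(d(x,z)+d(y,t),d(x,t)+d(y,z))$; $[a,b]$ is the segment between $a$ and $b$. A morphism $f:T\to T'$ between $\mathbb{R}$-trees is a map such that each segment of $T$ is a finite union of subsegments each mapped isometrically into $T'$; morphisms are assumed to be surjective. A $G$-tree is an $\mathbb{R}$-tree with an isometric action of $G$; two $G$-trees are considered equal if there is an equivariant isometry between them. Topology of $\mathcal{M}$: a fundamental system of neighborhoods of $f:T\to T_\infty$ is given by the sets $W_f(X,A,\varepsilon)$, with $X\subset T$ and $A\subset G$ finite, $\varepsilon>0$, where $f':T'\to T'_\infty$ is in $W_f(X,A,\varepsilon)$ if and only if there is a map $x\mapsto x'$ from $X$ to $T'$ such that $|d(x,gy)-d(x',gy')|<\varepsilon$ and $|d(f(x),f(gy))-d(f'(x'),f'(gy'))|<\varepsilon$ for all $x,y\in X$, $g\in A$. Construction of $\varphi_t,\psi_t$: let $f:T_0\to T_\infty$ be in $\mathcal{M}$, with $d_\infty$ the distance on $T_\infty$. For $a,b\in T_0$ with $f(a)=f(b)$, set $\tau(a,b)=\max_{x\in[a,b]}d_\infty(f(x),f(a))$.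 For $t\in[0,\infty)$, write $a\sim_t b$ if $f(a)=f(b)$ and $\tau(a,b)\le t$; this is an equivalence relation. Let $T_t=T_0/{\sim_t}$, let $\varphi_t:T_0\to T_t$ be the quotient map and $\psi_t:T_t\to T_\infty$ the map induced by $f$, so $f=\psi_t\circ\varphi_t$. A $t$-subdivision between $a,b\in T_0$ is a sequence $\sigma=(a=y_0,x_1,y_1,\dots,x_n,y_n,x_{n+1}=b)$ of points of $T_0$ with $y_i\sim_t x_{i+1}$ for $0\le i\le n$; its length is $|\sigma|=\sum_{i=1}^n d_0(x_i,y_i)$, where $d_0$ is the distance on $T_0$. The metric on $T_t$ is $d_t(\varphi_t(a),\varphi_t(b))=\inf_\sigma|\sigma|$ over all $t$-subdivisions between $a$ and $b$. With this metric $T_t$ is an $\mathbb{R}$-tree with an isometric $G$-action and $\varphi_t$, $\psi_t$ are equivariant morphisms. For $t=\infty$, $\varphi_\infty=f$ and $\psi_\infty=\mathrm{id}_{T_\infty}$. One writes $\Phi(f,t)=\varphi_t$, $\Psi(f,t)=\psi_t$. *)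

(* Defs.v *)
From HB Require Import structures.
From mathcomp Require Import all_boot all_order all_algebra.
From mathcomp Require Import all_classical all_reals all_analysis.
From mathcomp Require Import lra.

Set Implicit Arguments.
Unset Strict Implicit.
Unset Printing Implicit Defensive.

Import Order.TTheory GRing.Theory Num.Theory.
Import numFieldNormedType.Exports.

Local Open Scope classical_set_scope.
Local Open Scope ring_scope.

Section RTree.
Variables (R : realType) (T : metricType R).
Implicit Types a b c x y z : T.

Definition zero_hyperbolic : Prop := forall x y z t : T,
  mdist x y + mdist z t <=
    Num.max (mdist x z + mdist y t) (mdist x t + mdist y z).

Definition is_rtree : Prop := connected [set: T] /\ zero_hyperbolic.

(* In an R-tree, [a, b] consists of the points metrically between a and b.    *)
Definition segment a b : set T := [set x | mdist a x + mdist x b = mdist a b].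

Lemma segmentl a b : segment a b a.
Proof. by rewrite /segment/= mdistxx add0r. Qed.

Lemma segmentr a b : segment a b b.
Proof. by rewrite /segment/= mdistxx addr0. Qed.

Lemma segmentC a b : segment a b = segment b a.
Proof.
apply/seteqP; split => x; rewrite /segment/= => h.
  by rewrite (metric_sym b x) (metric_sym x a) addrC h metric_sym.
by rewrite (metric_sym a x) (metric_sym x b) addrC h metric_sym.
Qed.

Hypothesis treeT : is_rtree.

Lemma segment_cover a b c x :
  segment a c x -> segment a b x \/ segment b c x.
Proof.
rewrite /segment/= => h.
have := treeT.2 a c b x; have := metric_triangle a x b.
have := metric_triangle b x c.
rewrite (metric_sym c x) (metric_sym b x) (metric_sym c b) => h1 h2.
by rewrite le_max => /orP[|] h3; [left | right]; lra.
Qed.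

Lemma segment_dist a b x y : segment a b x -> segment a b y ->
  mdist x y = `|mdist a x - mdist a y|.
Proof.
rewrite /segment/= => hx hy.
have := treeT.2 x y a b; have := metric_triangle a x y.
have := metric_triangle a y x.
rewrite (metric_sym y x) (metric_sym x a) (metric_sym y a) => h1 h2.
rewrite le_max => /orP[|] h3; have [|] := leP (mdist a y) (mdist a x) => h4;
  by [rewrite ger0_norm ?subr_ge0//; lra | rewrite ltr0_norm ?subr_lt0//; lra].
Qed.

Lemma segment_point a b (r : R) : 0 <= r <= mdist a b ->
  exists2 x, segment a b x & mdist a x = r.
Proof.
move=> /andP[r0]; rewrite le_eqVlt => /predU1P[->|rL].
  by exists b => //; exact: segmentr.
apply: contrapT => nox.
pose g x := mdist a x + mdist a b - mdist x b.
have gL x y : `|g x - g y| <= mdist x y *+ 2.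
  rewrite /g ler_norml.
  have := metric_triangle a x y; have := metric_triangle a y x.
  have := metric_triangle x y b; have := metric_triangle y x b.
  by rewrite (metric_sym y x) mulr2n; lra.
have openP (P : set T) : (forall x, P x -> exists2 e, 0 < e &
    forall y, mdist x y < e -> P y) -> open P.
  move=> h; rewrite openE => x /h[e e0 he].
  rewrite /interior; apply/nbhs_ballP; exists e => // y.
  by rewrite ballEmdist => /he.
pose U := [set x | g x <= r *+ 2].
have oU : open U.
  apply: openP => x; rewrite /U/= => gx.
  have [gxr|gxr] := ltP (g x) (r *+ 2).
    exists ((r *+ 2 - g x) / 2); first by lra.
    move=> y xy; have := gL x y; rewrite ler_norml mulr2n; lra.
  have ax : 0 < mdist a x - r.
    rewrite lt_neqAle eq_sym subr_eq0; apply/andP; split.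
      apply/eqP => axr; apply: nox; exists x => //.
      by rewrite /segment/=; move: gx gxr; rewrite /g; lra.
    have := metric_triangle a x b; have := metric_triangle x a b.
    by rewrite (metric_sym x a); move: gx gxr; rewrite /g; lra.
  exists (mdist a x - r) => // y xy; rewrite leNgt; apply/negP => gy.
  have := treeT.2 a x y b; have := treeT.2 a y x b.
  have := metric_triangle y a b; have := metric_triangle x a b.
  have := metric_triangle a y x.
  move: gx gxr gy; rewrite /g (metric_sym y x) (metric_sym y a) (metric_sym x a).
  by rewrite !le_max => ? ? ? ? ? ? /orP[|] ? /orP[|] ?; lra.
have cU : closed U.
  rewrite -[U]setCK; apply: open_closedC; apply: openP => x.
  rewrite /U/= => /negP; rewrite -ltNge => gx.
  exists ((g x - r *+ 2) / 2); first by lra.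
  move=> y xy; apply/negP; rewrite -ltNge.
  by have := gL x y; rewrite ler_norml mulr2n; lra.
have Ua : U a by rewrite /U/= /g mdistxx mulr2n; lra.
have UT : U = setT.
  apply: treeT.1; first by exists a.
    by exists U; rewrite ?setTI.
  by exists U; rewrite ?setTI.
have : U b by rewrite UT.
by rewrite /U/= /g mdistxx mulr2n; lra.
Qed.

End RTree.

Section Spaces.
Variables (R : realType) (G : groupType).

(* The universes of MathComp are monomorphic, and [metricType R] is too large *)
(* to be quantified over inside a type that carries a topology; the carrier   *)
(* and its structure are packed again, one universe level below.              *)
Record smetric := SMetric {
  smetric_sort :> Type;
  smetric_class : Metric.axioms_ R smetric_sort
}.

HB.instance Definition _ (T : smetric) := smetric_class T.

Record gspace := GSpace {
  gcarrier :> smetric;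
  gact : G -> gcarrier -> gcarrier;
  gact1 : forall x, gact 1%g x = x;
  gactM : forall g h x, gact (g * h)%g x = gact g (gact h x);
  gact_isom : forall g x y, mdist (gact g x) (gact g y) = mdist x y
}.

Record gmap := GMap {
  gsource : gspace;
  gtarget : gspace;
  gfun :> gsource -> gtarget;
  gfunJ : forall g x, gfun (gact g x) = gact g (gfun x)
}.

Definition is_morphism (T T' : metricType R) (f : T -> T') : Prop :=
  forall a b : T, exists2 s : seq (T * T),
    segment a b = \bigcup_(p in [set` s]) segment p.1 p.2 &
    forall p, p \in s -> {in segment p.1 p.2 &, forall x y,
      mdist (f x) (f y) = mdist x y}.

Record gmor := GMor {
  gmor_map :> gmap;
  gmor_source : is_rtree (gsource gmor_map);
  gmor_target : is_rtree (gtarget gmor_map);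
  gmor_surj : range gmor_map = setT;
  gmor_morph : is_morphism gmor_map
}.

(* [h] is defined on the type of the elements of [X]. *)
Definition gmor_ball (f : gmor) (X : set (gsource f)) (A : set G) (e : R) :
    set gmor :=
  [set f' : gmor | exists h : X -> gsource f', forall (x y : X) (g : G), A g ->
     `|mdist (val x) (gact g (val y)) - mdist (h x) (gact g (h y))| < e /\
     `|mdist (f (val x)) (f (gact g (val y))) -
       mdist (f' (h x)) (f' (gact g (h y)))| < e].

Definition gmor_nbhs (f : gmor) : set_system gmor :=
  [set U | exists (X : set (gsource f)) (A : set G) (e : R),
     [/\ finite_set X, finite_set A, 0 < e & gmor_ball X A e `<=` U]].

HB.instance Definition _ := gen_eqMixin gmor.
HB.instance Definition _ := gen_choiceMixin gmor.
HB.instance Definition _ := hasNbhs.Build gmor gmor_nbhs.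

Lemma gmor_ball_refl (f : gmor) (X : set (gsource f)) A e :
  0 < e -> gmor_ball X A e f.
Proof. by move=> e0; exists val => x y g _; rewrite !subrr normr0. Qed.

Lemma gmor_ball_sub (f : gmor) (X X' : set (gsource f)) A A' e e' :
  X `<=` X' -> A `<=` A' -> e' <= e -> gmor_ball X' A' e' `<=` gmor_ball X A e.
Proof.
move=> XX' AA' ee f' [h hP].
have i (x : X) : set_val x \in X' by apply/mem_set/XX'/set_valP.
pose j x : X' := exist (fun z => z \in X') (set_val x) (i x).
exists (h \o j) => x y g /AA' Ag; have [/= h1 h2] := hP (j x) (j y) g Ag.
by split; [apply: lt_le_trans h1 ee | apply: lt_le_trans h2 ee].
Qed.

Fact gmor_nbhs_filter (f : gmor) : ProperFilter (nbhs f).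
Proof.
split.
  by move=> [X [A [e [_ _ e0]]]] /(_ f)/(_ (gmor_ball_refl _ _ e0)).
split.
- by exists set0, set0, 1; split.
- move=> P Q [X [A [e [fX fA e0 XP]]]] [Y [B [d [fY fB d0 YQ]]]].
  exists (X `|` Y), (A `|` B), (Num.min e d).
  rewrite !finite_setU lt_min e0 d0; split => // f' Wf'; split.
    apply: XP; apply: gmor_ball_sub Wf'; [exact: subsetUl|exact: subsetUl|].
    by rewrite ge_min lexx.
  apply: YQ; apply: gmor_ball_sub Wf'; [exact: subsetUr|exact: subsetUr|].
  by rewrite ge_min lexx orbT.
- move=> P Q PQ [X [A [e [fX fA e0 XP]]]]; exists X, A, e; split => //.
  exact: subset_trans PQ.
Qed.

Fact gmor_nbhs_singleton (f : gmor) (U : set gmor) : nbhs f U -> U f.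
Proof. by move=> [X [A [e [_ _ e0]]]]; apply; exact: gmor_ball_refl. Qed.

Lemma finite_slack (I : choiceType) (D : set I) (u : I -> R) (e : R) :
  finite_set D -> (forall i, D i -> u i < e) ->
  exists2 d, 0 < d & forall i, D i -> u i + d <= e.
Proof.
move=> /finite_seqP[s ->]; elim: s => [|i s IH] h; first by exists 1.
have [|d d0 dP] := IH; first by move=> j /= js; apply: h; rewrite /= inE js orbT.
exists (Num.min d (e - u i)).
  by rewrite lt_min d0 subr_gt0 h//= inE eqxx.
move=> j /=; rewrite inE => /predU1P[->|js].
  by rewrite -lerBrDl ge_min lexx orbT.
by rewrite (le_trans _ (dP _ js))// lerD2l ge_min lexx.
Qed.

Fact gmor_nbhs_nbhs (f : gmor) (U : set gmor) :
  nbhs f U -> nbhs f (nbhs^~ U).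
Proof.
move=> [X [A [e [fX fA e0 XU]]]]; exists X, A, e; split => // f' [h hP].
pose u (i : X * X * G) : R := Num.max
  `|mdist (val i.1.1) (gact i.2 (val i.1.2)) -
    mdist (h i.1.1) (gact i.2 (h i.1.2))|
  `|mdist (f (val i.1.1)) (f (gact i.2 (val i.1.2))) -
    mdist (f' (h i.1.1)) (f' (gact i.2 (h i.1.2)))|.
have fXT : finite_set [set: X] by rewrite (eq_finite_set (card_setT X)).
have fD : finite_set ([set: X] `*` [set: X] `*` A).
  by apply: finite_setX => //; apply: finite_setX.
have [i [_ Ai]|d d0 ud] := finite_slack (u := u) (e := e) fD.
  by rewrite gt_max; apply/andP/hP.
exists (range h), A, d; split => //; first exact: finite_image.
move=> f'' [k kP]; apply: XU.
have i (x : X) : h x \in range h by apply/mem_set; exists x.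
pose j x : range h := exist (fun z => z \in range h) (h x) (i x).
exists (k \o j) => x y g Ag.
have := ud (x, y, g) (conj (conj I I) Ag).
have [] := kP (j x) (j y) g Ag.
rewrite /u /= -lerBrDr ge_max => h1 h2 /andP[h3 h4]; split.
  rewrite (le_lt_trans (ler_distD (mdist (h x) (gact g (h y))) _ _))//.
  by lra.
rewrite (le_lt_trans (ler_distD (mdist (f' (h x)) (f' (gact g (h y)))) _ _))//.
by lra.
Qed.

HB.instance Definition _ := @Nbhs_isNbhsTopological.Build gmor
  gmor_nbhs_filter gmor_nbhs_singleton gmor_nbhs_nbhs.

(* Isomorphic morphisms are not identified, but they have the same            *)
(* neighborhoods, so that continuity is insensitive to the identification.    *)
Definition gmor_iso (f f' : gmor) : Prop :=
  exists (h : gsource f -> gsource f') (k : gtarget f -> gtarget f'),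
    [/\ (forall x y, mdist (h x) (h y) = mdist x y) /\ range h = setT,
        (forall x y, mdist (k x) (k y) = mdist x y) /\ range k = setT,
        forall g x, h (gact g x) = gact g (h x),
        forall g x, k (gact g x) = gact g (k x) &
        forall x, f' (h x) = k (f x)].

Lemma gmor_iso_nbhs (f f' : gmor) : gmor_iso f f' -> nbhs f = nbhs f'.
Proof.
move=> [h [k [[hd hT] [kd kT] hJ kJ fh]]]; apply/seteqP; split=> U.
  move=> /gmor_nbhs_nbhs[X [A [e [_ _ e0]]]]; apply.
  exists (h \o val) => x y g _ /=.
  by rewrite -hJ !fh hd kd !subrr normr0.
move=> /gmor_nbhs_nbhs[X [A [e [_ _ e0]]]]; apply.
have hS x' : exists x, h x = x'.
  have [x _ <-] : range h x' by rewrite hT.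
  by exists x.
pose l x' := projT1 (cid (hS x')).
have hl x' : h (l x') = x' by rewrite /l; case: cid.
exists (l \o val) => x y g _ /=.
rewrite -[in mdist (val x) _](hl (val x)) -[in gact g (val y)](hl (val y)).
rewrite -[in f' (val x)](hl (val x)) -hJ !fh hd kd !subrr normr0.
by [].
Qed.

Definition ext_nonneg : Type := [set t : \bar R | (0 <= t)%E].
End Spaces.

Section Lipschitz.
Variables (R : realType) (T T' : metricType R) (f : T -> T').
Hypotheses (treeT : is_rtree T) (morf : is_morphism f).

Let local_piece (x : T) (p : T * T) :
  {in segment p.1 p.2 &, forall y z, mdist (f y) (f z) = mdist y z} ->
  exists2 e, 0 < e & forall y, segment p.1 p.2 y -> mdist x y < e ->
    mdist (f x) (f y) <= mdist x y.
Proof.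
move=> isof; have [px|px] := pselect (segment p.1 p.2 x).
  by exists 1 => // y py _; rewrite isof ?inE.
exists ((mdist p.1 x + mdist x p.2 - mdist p.1 p.2) / 2).
  rewrite divr_gt0// subr_gt0 lt_neqAle metric_triangle andbT.
  by apply/eqP => h; apply: px.
move=> y; rewrite /segment/= => py xy.
have := metric_triangle p.1 y x; have := metric_triangle x y p.2.
by rewrite (metric_sym y x); lra.
Qed.

Let local_pieces (x : T) (s : seq (T * T)) :
  (forall p, p \in s ->
    {in segment p.1 p.2 &, forall y z, mdist (f y) (f z) = mdist y z}) ->
  exists2 e, 0 < e & forall y,
    (\bigcup_(p in [set` s]) segment p.1 p.2) y -> mdist x y < e ->
    mdist (f x) (f y) <= mdist x y.
Proof.
elim: s => [|p s IH] isof; first by exists 1 => // y [].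
have [|e e0 he] := IH; first by move=> q qs; apply: isof; rewrite inE qs orbT.
have [|d d0 hd] := @local_piece x p; first by apply: isof; rewrite inE eqxx.
exists (Num.min d e); first by rewrite lt_min d0.
move=> y [q /=]; rewrite inE lt_min => /predU1P[->|qs] qy /andP[h1 h2].
  exact: hd.
by apply: he => //; exists q.
Qed.

Lemma morphism_lipschitz a b : mdist (f a) (f b) <= mdist a b.
Proof.
have [s sE isof] := morf a b.
have loc x : exists2 e, 0 < e & forall y, segment a b y -> mdist x y < e ->
    mdist (f x) (f y) <= mdist x y.
  by have [e e0 he] := local_pieces x isof; exists e => // y; rewrite sE; exact: he.
pose S := [set r | 0 <= r <= mdist a b /\ forall x, segment a b x ->
  mdist a x <= r -> mdist (f a) (f x) <= mdist a x].
have S0 : S 0.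
  split=> [|x _]; first by rewrite lexx mdist_ge0.
  move=> ax; have /mdist_positivity <- : mdist a x = 0.
    by apply/eqP; rewrite eq_le ax mdist_ge0.
  by rewrite !mdistxx.
have supS : has_sup S.
  by split; [exists 0 | exists (mdist a b) => r [/andP[]]].
pose l := sup S.
have l0 : 0 <= l by exact: sup_upper_bound.
have lL : l <= mdist a b by apply: ge_sup; [exists 0 | move=> r [/andP[]]].
have [c abc acl] := segment_point treeT (introT andP (conj l0 lL)).
have [e e0 loce] := loc c.
have [r Sr rl] := sup_adherent e0 supS.
have rlel : r <= l by exact: sup_upper_bound.
have fac : mdist (f a) (f c) <= l.
  have [x abx axr] := segment_point treeT Sr.1.
  have xc : mdist c x = l - r.
    by rewrite (segment_dist treeT abc abx) acl axr ger0_norm ?subr_ge0.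
  have := metric_triangle (f a) (f x) (f c).
  have := Sr.2 x abx; rewrite axr lexx => /(_ isT).
  have := loce x abx; rewrite xc (metric_sym (f x)) => h1 h2.
  suff /h1 : l - r < e by lra.
  by rewrite -/l in rl; lra.
have next x : segment a b x -> l <= mdist a x < l + e ->
    mdist (f a) (f x) <= mdist a x.
  move=> abx /andP[lx xl].
  have cx : mdist c x = mdist a x - l.
    by rewrite (segment_dist treeT abc abx) acl distrC ger0_norm ?subr_ge0.
  have := metric_triangle (f a) (f c) (f x).
  have := loce x abx; rewrite cx => h1; have /h1 : mdist a x - l < e by lra.
  by lra.
have := lL; rewrite le_eqVlt => /predU1P[lE|ltL].
  by apply: next; [exact: segmentr | rewrite -lE; lra].
have Sm : S (Num.min (mdist a b) (l + e / 2)).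
  split=> [|x abx]; first by rewrite ge_min lexx le_min mdist_ge0/=; lra.
  rewrite le_min => /andP[_ xl]; have [lx|lx] := leP l (mdist a x).
    by apply: next => //; rewrite lx; lra.
  have lx0 : 0 < l - mdist a x by rewrite subr_gt0.
  have [r' [_ Sr'] r'l] := sup_adherent lx0 supS.
  by apply: Sr' => //; rewrite -/l in r'l; lra.
have := sup_upper_bound supS Sm; rewrite -/l ge_min.
by move=> /orP[]; lra.
Qed.

End Lipschitz.

Section Fold.
Variables (R : realType) (G : groupType) (f : gmor R G) (t : ext_nonneg R).
Implicit Types a b c x y : gsource f.

(* tau(a, b): the supremum is a maximum, the segment [a, b] being compact.    *)
Definition fold_height a b : \bar R :=
  ereal_sup [set (mdist (f x) (f a))%:E | x in segment a b].

Definition fold_rel a b : Prop :=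
  f a = f b /\ (fold_height a b <= val t)%E.

Lemma fold_relE a b : fold_rel a b <-> f a = f b /\
  forall x, segment a b x -> ((mdist (f x) (f a))%:E <= val t)%E.
Proof.
split=> -[fab h]; split => //.
  move=> x abx; apply: le_trans h; apply: ereal_sup_ubound; by exists x.
by apply: ge_ereal_sup => _ [x abx <-]; exact: h.
Qed.

Lemma fold_rel_refl a : fold_rel a a.
Proof.
apply/fold_relE; split => // x; rewrite /segment/= mdistxx => h.
have /mdist_positivity <- : mdist a x = 0.
  by have := mdist_ge0 a x; have := mdist_ge0 x a; lra.
by rewrite mdistxx; exact: (set_valP t).
Qed.

Lemma fold_rel_sym a b : fold_rel a b -> fold_rel b a.
Proof.
move=> /fold_relE[fab h]; apply/fold_relE; split=> // x.
by rewrite -fab segmentC; exact: h.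
Qed.

Lemma fold_rel_trans a b c : fold_rel a b -> fold_rel b c -> fold_rel a c.
Proof.
move=> /fold_relE[fab h] /fold_relE[fbc k]; apply/fold_relE; split.
  by rewrite fab.
move=> x /(segment_cover (gmor_source f) b)[/h//|/k].
by rewrite fab.
Qed.

Lemma fold_relJ g a b : fold_rel a b -> fold_rel (gact g a) (gact g b).
Proof.
move=> /fold_relE[fab h]; apply/fold_relE; split; first by rewrite !gfunJ fab.
have gK (x : gsource f) : x = gact g (gact g^-1%g x).
  by rewrite -gactM mulgV gact1.
move=> x; rewrite (gK x); move: (gact _ x) => y sy.
rewrite !gfunJ gact_isom; apply: h.
by move: sy; rewrite /segment/= !gact_isom.
Qed.

(* [s] lists the pairs (x_1, y_1), ..., (x_n, y_n) of the subdivision         *)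
(* (a = y_0, x_1, y_1, ..., x_n, y_n, x_{n+1} = b).                           *)
Fixpoint subdivision a (s : seq (gsource f * gsource f)) b : Prop :=
  if s is (x, y) :: s' then fold_rel a x /\ subdivision y s' b
  else fold_rel a b.

Definition subdivision_length (s : seq (gsource f * gsource f)) : R :=
  \sum_(p <- s) mdist p.1 p.2.

Definition fold_dist a b : R :=
  inf [set subdivision_length s | s in [set s | subdivision a s b]].


Lemma subdivision_length_ge0 s : 0 <= subdivision_length s.
Proof. by apply: sumr_ge0 => p _; exact: mdist_ge0. Qed.

Lemma subdivision_cat a b c s s' :
  subdivision a s b -> subdivision b s' c -> subdivision a (s ++ s') c.
Proof.
elim: s a => [|[x y] s IH] a /=; last by move=> [ax ys] /(IH _ ys).
case: s' => [|[x y] s'] /= ab; first exact: fold_rel_trans.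
by move=> [bx ?]; split => //; exact: fold_rel_trans bx.
Qed.

Lemma subdivision_rev a b s : subdivision a s b ->
  exists2 s', subdivision b s' a & subdivision_length s' = subdivision_length s.
Proof.
elim: s a => [|[x y] s IH] a /=.
  by move=> ab; exists [::] => //; exact: fold_rel_sym.
move=> [ax /IH[s' bs' lE]]; exists (s' ++ [:: (y, x)]).
  apply: subdivision_cat bs' _ => /=; split; first exact: fold_rel_refl.
  exact: fold_rel_sym.
rewrite /subdivision_length big_cat/= big_cons big_nil addr0/= addrC.
by rewrite /subdivision_length in lE; rewrite lE big_cons metric_sym.
Qed.

Lemma subdivisionJ g a b s : subdivision a s b ->
  exists2 s', subdivision (gact g a) s' (gact g b) &
    subdivision_length s' = subdivision_length s.
Proof.
elim: s a => [|[x y] s IH] a /=.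
  by move=> ab; exists [::] => //; exact: fold_relJ.
move=> [ax /IH[s' bs' lE]]; exists ((gact g x, gact g y) :: s').
  by split => //; exact: fold_relJ.
rewrite /subdivision_length !big_cons/= gact_isom.
by rewrite /subdivision_length in lE; rewrite lE.
Qed.

Let dist_set a b :=
  [set subdivision_length s | s in [set s | subdivision a s b]].

Let dist_set_neq0 a b : dist_set a b !=set0.
Proof.
exists (subdivision_length [:: (a, b)]), [:: (a, b)] => //=.
by split; exact: fold_rel_refl.
Qed.

Let dist_set_inf a b : has_inf (dist_set a b).
Proof.
split; first exact: dist_set_neq0.
by exists 0 => _ [s _ <-]; exact: subdivision_length_ge0.
Qed.

Lemma fold_dist_le a b s :
  subdivision a s b -> fold_dist a b <= subdivision_length s.
Proof.
by move=> h; apply: (ge_inf (proj2 (dist_set_inf a b))); exists s.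
Qed.

Lemma fold_dist_adherent a b e : 0 < e ->
  exists2 s, subdivision a s b & subdivision_length s < fold_dist a b + e.
Proof.
move=> e0; have [_ [s h <-] ?] := inf_adherent e0 (dist_set_inf a b).
by exists s.
Qed.

Lemma fold_dist_ge0 a b : 0 <= fold_dist a b.
Proof.
apply: lb_le_inf; first exact: dist_set_neq0.
by move=> _ [s _ <-]; exact: subdivision_length_ge0.
Qed.

Lemma fold_dist_sym a b : fold_dist a b = fold_dist b a.
Proof.
congr inf; apply/seteqP; split=> _ [s /subdivision_rev[s' h lE] <-];
  by exists s'.
Qed.

Lemma fold_dist_triangle b a c : fold_dist a c <= fold_dist a b + fold_dist b c.
Proof.
apply/ler_addgt0Pl => e e0; have e20 : 0 < e / 2 by rewrite divr_gt0.
have [s h1 l1] := fold_dist_adherent a b e20.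
have [s' h2 l2] := fold_dist_adherent b c e20.
rewrite (le_trans (fold_dist_le (subdivision_cat h1 h2)))//.
by rewrite /subdivision_length big_cat/= -!/(subdivision_length _); lra.
Qed.

Lemma fold_dist_rel a b : fold_rel a b -> fold_dist a b = 0.
Proof.
move=> ab; apply/eqP; rewrite eq_le fold_dist_ge0 andbT.
rewrite (le_trans (@fold_dist_le _ _ [::] ab))//.
by rewrite /subdivision_length big_nil.
Qed.

Lemma fold_distJ g a b : fold_dist (gact g a) (gact g b) = fold_dist a b.
Proof.
congr inf; apply/seteqP; split=> _ [s /= h <-]; last first.
  by have [s' ? ?] := subdivisionJ g h; exists s'.
have [s' h' lE] := subdivisionJ g^-1%g h; exists s' => //=.
by move: h'; rewrite -!gactM mulVg !gact1.
Qed.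

Lemma subdivision_bound a b s : subdivision a s b ->
  mdist (f a) (f b) <= subdivision_length s /\
  forall x, segment a b x ->
    ((mdist (f x) (f a))%:E <= val t + (subdivision_length s)%:E)%E.
Proof.
elim: s a => [|[x1 y1] s IH] a /=.
  move=> /fold_relE[-> h]; rewrite mdistxx /subdivision_length big_nil adde0.
  by split => // x /h.
move=> [/fold_relE[fax h] /IH[d1 d2]].
rewrite /subdivision_length big_cons /= -/(subdivision_length s).
have lip := morphism_lipschitz (gmor_source f) (@gmor_morph _ _ f).
have s0 := subdivision_length_ge0 s.
have lxy := lip x1 y1; have t0 : (0%:E <= val t)%E := set_valP t.
split; first by have := metric_triangle (f x1) (f y1) (f b); rewrite fax; lra.
move=> x /(segment_cover (gmor_source f) x1)[/h|].
  by move=> /le_trans; apply; rewrite leeDl// lee_fin addr_ge0// mdist_ge0.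
rewrite fax => /(segment_cover (gmor_source f) y1)[|/d2].
  rewrite /segment/= => xs.
  apply: (@le_trans _ _ (mdist x1 y1 + subdivision_length s)%:E).
    rewrite lee_fin; have := lip x x1; have := mdist_ge0 x y1.
    by rewrite (metric_sym x x1); lra.
  by rewrite leeDr.
move=> h2; apply: (@le_trans _ _ ((mdist (f x) (f y1))%:E + (mdist x1 y1)%:E)%E).
  rewrite -EFinD lee_fin; have := metric_triangle (f x) (f y1) (f x1).
  by rewrite (metric_sym (f y1) (f x1)); lra.
by rewrite (addrC (mdist x1 y1)) EFinD addeA leeD2r.
Qed.

Lemma fold_dist_eq0 a b : fold_dist a b = 0 -> fold_rel a b.
Proof.
move=> ab0; apply/fold_relE; split.
  apply/mdist_positivity/eqP; rewrite eq_le mdist_ge0 andbT.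
  apply/ler_addgt0Pl => e /(fold_dist_adherent a b)[s /subdivision_bound[h _]].
  by rewrite ab0; lra.
move=> x abx; apply/lee_addgt0Pr => e /(fold_dist_adherent a b)[s].
move=> /subdivision_bound[_ /(_ x abx) h]; rewrite ab0 add0r => se.
by rewrite (le_trans h)// leeD2l// lee_fin ltW.
Qed.

(* The quotient is the type of the equivalence classes; the type of           *)
(* [generic_quotient] would be too large for [smetric].                       *)
Definition fold_type : Type :=
  {C : gsource f -> Prop | exists a, C = fold_rel a}.

HB.instance Definition _ := gen_eqMixin fold_type.
HB.instance Definition _ := gen_choiceMixin fold_type.

Definition fold_pi a : fold_type :=
  exist _ (fold_rel a) (ex_intro _ a erefl).

Definition fold_repr (u : fold_type) : gsource f := projT1 (cid (proj2_sig u)).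

Lemma fold_reprK : cancel fold_repr fold_pi.
Proof.
move=> [C CP]; rewrite /fold_repr /=; case: cid => a /= Ca.
exact/eq_exist/esym.
Qed.

Lemma fold_piP a b : fold_pi a = fold_pi b <-> fold_rel a b.
Proof.
split=> [[->]|ab]; first exact: fold_rel_refl.
apply/eq_exist/funext => x; apply/propext; split.
  by apply: fold_rel_trans; exact: fold_rel_sym.
exact: fold_rel_trans ab.
Qed.

Let reprP a : fold_rel (fold_repr (fold_pi a)) a.
Proof. by apply/fold_piP; rewrite fold_reprK. Qed.

Definition fold_mdist (u v : fold_type) : R :=
  fold_dist (fold_repr u) (fold_repr v).

Lemma fold_mdistE a b : fold_mdist (fold_pi a) (fold_pi b) = fold_dist a b.
Proof.
rewrite /fold_mdist; apply/eqP; rewrite eq_le; apply/andP; split.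
  rewrite (le_trans (fold_dist_triangle a _ _))// (fold_dist_rel (reprP a)) add0r.
  rewrite (le_trans (fold_dist_triangle b _ _))//.
  by rewrite (fold_dist_sym b) (fold_dist_rel (reprP b)) addr0.
rewrite (le_trans (fold_dist_triangle (fold_repr (fold_pi a)) _ _))//.
rewrite fold_dist_sym (fold_dist_rel (reprP a)) add0r.
rewrite (le_trans (fold_dist_triangle (fold_repr (fold_pi b)) _ _))//.
by rewrite (fold_dist_rel (reprP b)) addr0.
Qed.

Fact fold_mdistxx u : fold_mdist u u = 0.
Proof. by rewrite /fold_mdist fold_dist_rel//; exact: fold_rel_refl. Qed.

Fact fold_mdist_positivity u v : fold_mdist u v = 0 -> u = v.
Proof.
by move=> /fold_dist_eq0/fold_piP; rewrite !fold_reprK.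
Qed.

HB.instance Definition _ := @isMetric.Build R fold_type fold_mdist
  fold_mdistxx fold_mdist_positivity
  (fun _ _ => fold_dist_sym _ _) (fun _ _ _ => fold_dist_triangle _ _ _).

Definition fold_act (g : G) (u : fold_type) : fold_type :=
  fold_pi (gact g (fold_repr u)).

Lemma fold_actE g a : fold_act g (fold_pi a) = fold_pi (gact g a).
Proof. by apply/fold_piP/fold_relJ. Qed.

Lemma fold_pi_surj u : exists a, u = fold_pi a.
Proof. by exists (fold_repr u); rewrite fold_reprK. Qed.

Fact fold_act1 u : fold_act 1%g u = u.
Proof. by have [a ->] := fold_pi_surj u; rewrite fold_actE gact1. Qed.

Fact fold_actM g h u : fold_act (g * h)%g u = fold_act g (fold_act h u).
Proof. by have [a ->] := fold_pi_surj u; rewrite !fold_actE gactM. Qed.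

Fact fold_act_isom g (u v : fold_type) :
  mdist (fold_act g u) (fold_act g v) = mdist u v.
Proof.
have [a ->] := fold_pi_surj u; have [b ->] := fold_pi_surj v.
by rewrite !fold_actE /mdist/= !fold_mdistE fold_distJ.
Qed.

Definition fold_gspace : gspace R G :=
  @GSpace R G (@SMetric R fold_type (Metric.class (fold_type : metricType R)))
    fold_act fold_act1 fold_actM fold_act_isom.

Definition fold_phi : gmap R G :=
  @GMap R G (gsource f) fold_gspace fold_pi (fun g a => esym (fold_actE g a)).

Definition fold_induced (u : fold_gspace) : gtarget f := f (fold_repr u).

Lemma fold_inducedE a : fold_induced (fold_pi a) = f a.
Proof. by rewrite /fold_induced; case: (reprP a). Qed.

Fact fold_inducedJ g u : fold_induced (gact g u) = gact g (fold_induced u).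
Proof.
by have [a ->] := fold_pi_surj u; rewrite /gact/= fold_actE !fold_inducedE gfunJ.
Qed.

Definition fold_psi : gmap R G := GMap fold_inducedJ.

(* At t = +oo, Phi and Psi are f and the identity of T_oo by convention. That *)
(* these maps are points of [gmor R G] is not proved here.                    *)
Definition Phi_map : gmap R G :=
  if val t is +oo%E then gmor_map f else fold_phi.

Definition Psi_map : gmap R G :=
  if val t is +oo%E then @GMap R G (gtarget f) (gtarget f) id (fun _ _ => erefl)
  else fold_psi.

End Fold.

(* Main.v *)
(* The distance of T_t has an explicit form. Cut [a, b] at points w_1, ...,    *)
(* w_n into pieces of length at most t on which f is isometric; then           *)
(* d_t(a, b) is the length of the shortest path of T_oo from f(a) to f(b)      *)
(* that visits, in this order, the balls of radius t around the f(w_i). A      *)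
(* subdivision from a to b yields such a path that is not longer, even when it *)
(* leaves [a, b]; conversely, the shortest path is the one that moves only     *)
(* when it has to, and its moves lift to T_0 up to ~_t. Balls of a tree are    *)
(* gated, so the shortest path splits at any ball that it visits, and          *)
(* 0-hyperbolicity of T_t reduces to the four-point condition of T_oo for the  *)
(* points where the paths enter a ball.                                        *)
(*                                                                             *)
(* The formula is a continuous function of t and of the finitely many          *)
(* distances between the f(w_i), whence the lower semicontinuity of d_t in     *)
(* (f, t). For the upper semicontinuity at 0 < t < oo, the formula lets one    *)
(* replace t by some s < t, and a nearly optimal s-subdivision is carried to   *)
(* any nearby f', where its jumps have length almost 0 because s < t. At       *)
(* t = oo, d_t'(a, b) = d_oo(f(a), f(b)) as soon as t' >= d_0(a, b).           *)

Require Import Defs.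
From mathcomp Require Import all_boot all_order all_algebra.
From mathcomp Require Import all_classical all_reals all_analysis.
From mathcomp Require Import lra zify.

Set Implicit Arguments.
Unset Strict Implicit.
Unset Printing Implicit Defensive.

Import Order.TTheory GRing.Theory Num.Theory.
Import numFieldNormedType.Exports.

Local Open Scope classical_set_scope.
Local Open Scope ring_scope.

(** * Segments of R-trees *)

(** All the distances involved can be read on T_0. Through quotient maps from T_0, the sources and
    targets of phi_t and psi_t carry the pseudo-distances d_0, d_t and d_oo(f(.), f(.)), with d_t
    read as the last one at t = oo ([level_dist]). By [stable_continuous] it suffices that, for
    fixed a and b, d_t(a, b) changes little when t' is near t and f' is nearly isometric to f on a
    suitable finite set of points ([level_dist_stable]); the group only adds finitely many points g
    y to this set.

    The difficulty is that d_t is an infimum over subdivisions that wander through all of T_0.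
    [fold_distE] turns it into the length [taut] of a shortest path in T_oo, which depends on
    finitely many distances only: [subdivision_visits] gives one inequality, the lifting step
    [follow] the other. [taut_close] bounds the effect of perturbing these distances and the radius.
    The lower bound [taut_le_fold_dist] holds for any monotone chain, so it can be used for f' and
    gives [fold_dist_lower]. The upper bound asks for isometric pieces, which f' need not have at
    the same places; [fold_dist_upper] therefore carries over a subdivision of a slightly lower
    level, whose jumps remain almost free.

    The formula also yields 0-hyperbolicity of T_t ([fold_dist_hyperbolic]), and d_oo <= d_t <= d_0
    makes the pieces on which f is isometric serve for phi_t and psi_t. *)

Section MetricFacts.
Variables (R : realType) (T : metricType R).
Implicit Types a b c x y z : T.

(** Symmetry is included because [lra] treats [mdist a b] and [mdist b a] as unrelated unknowns. *)
Lemma metric3 a b c :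
  [/\ mdist a b = mdist b a, mdist b c = mdist c b, mdist a c = mdist c a &
   [/\ mdist a b <= mdist a c + mdist b c, mdist b c <= mdist a b + mdist a c &
     mdist a c <= mdist a b + mdist b c]].
Proof.
have := metric_triangle a c b; have := metric_triangle b a c.
have := metric_triangle a b c.
by rewrite (metric_sym b a) (metric_sym c b) (metric_sym c a).
Qed.

Lemma mdist_eq0_le a b : mdist a b <= 0 -> a = b.
Proof.
by move=> ab; apply: mdist_positivity; apply/eqP; rewrite eq_le ab mdist_ge0.
Qed.

End MetricFacts.

Ltac tri a b c :=
  let H := fresh in have H := metric3 a b c;
  case: H => ? ? ? [? ? ?].

Section Tree.
Variables (R : realType) (T : metricType R).
Hypothesis treeT : is_rtree T.
Implicit Types a b c m p q x y z : T.

Lemma rtree4 a b c x :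
  mdist a b + mdist c x <= mdist a c + mdist b x \/
  mdist a b + mdist c x <= mdist a x + mdist b c.
Proof. by have := treeT.2 a b c x; rewrite le_max => /orP. Qed.

Lemma segment_trans a b x y : segment a b x -> segment x b y ->
  segment a b y /\ segment a y x.
Proof.
rewrite /segment/= => h1 h2; tri a x y; tri x y b; tri a y b; tri a x b; split; lra.
Qed.

Lemma segment_transl a b x y : segment a b x -> segment a x y ->
  segment a b y /\ segment y b x.
Proof.
rewrite /segment/= => h1 h2; tri a x y; tri x y b; tri a y b; tri a x b; split; lra.
Qed.

Lemma segment_split a b x y : segment a b x -> segment a b y ->
  segment a x y \/ segment x b y.
Proof.
rewrite /segment/= => h1 h2; tri a x y; tri x y b.
have := segment_dist treeT h1 h2; have [h3|h3] := leP (mdist a x) (mdist a y).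
  by rewrite distrC ger0_norm ?subr_ge0// => ?; right; lra.
by rewrite ger0_norm ?subr_ge0 ?ltW// => ?; left; lra.
Qed.

Lemma segment_convex a b x y z :
  segment a b x -> segment a b y -> segment x y z -> segment a b z.
Proof.
rewrite /segment/= => h1 h2 h3; tri a x y; tri x y b; tri a x z; tri b x z.
tri a y z; tri b y z; tri a z b.
have := segment_dist treeT h1 h2; have [h4|h4] := leP (mdist a x) (mdist a y).
  by rewrite distrC ger0_norm ?subr_ge0// => ?; lra.
by rewrite ger0_norm ?subr_ge0 ?ltW// => ?; lra.
Qed.

(** Coming from z one meets [a, b] on one side of m, so the geodesic from z to the endpoint on the
    other side passes through m. *)
Lemma segment_distE a b m z : segment a b m ->
  mdist m z = mdist a z - mdist a m \/ mdist m z = mdist b z - mdist b m.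
Proof.
rewrite /segment/= => h; have := rtree4 m z a b; tri a m z; tri b m z; tri a m b.
by tri a z b; move=> [] ?; [right|left]; lra.
Qed.

Lemma segment_ball a b m z (r : R) : segment a b m ->
  mdist z a <= r -> mdist z b <= r -> mdist z m <= r.
Proof.
move=> h; have := segment_distE z h; tri z a m; tri z b m.
by have := mdist_ge0 a m; have := mdist_ge0 b m; move=> ? ? []; lra.
Qed.

Lemma segment_inj a b x y : segment a b x -> segment a b y ->
  mdist a x = mdist a y -> x = y.
Proof.
move=> h1 h2 h; apply: mdist_positivity.
by rewrite (segment_dist treeT h1 h2) h subrr normr0.
Qed.

Lemma median a b c :
  exists m, [/\ segment a b m, segment b c m & segment a c m].
Proof.
tri a b c.
(* The radius is the Gromov product of b and c at a, the distance from a to the branch point. *)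
have [|m abm am] :=
    segment_point (a := a) (b := b) (r := (mdist a b + mdist a c - mdist b c) / 2) treeT.
  by apply/andP; split; lra.
exists m; split=> //; have := segment_distE c abm; move: abm.
by rewrite /segment/=; tri a m c; tri b m c; tri a m b; move=> ? []?; lra.
by rewrite /segment/=; tri a m c; tri b m c; tri a m b; move=> ? []?; lra.
Qed.

(* The shape of the hull of four points: pairs [x, y] and [z, t] hang off     *)
(* the bridge [m, n].                                                         *)
Definition bridge x y z t m n :=
  [/\ segment x y m, segment z t n &
   [/\ segment x z m /\ segment m z n, segment x t m /\ segment m t n,
       segment y z m /\ segment m z n & segment y t m /\ segment m t n]].

(** When the pairing xy|zt has the smallest sum, the branch point m of x, y, z also lies on [x, t]
    and [y, t]; the other end of the bridge is the branch point of z, t, m. *)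
Lemma bridge_exists x y z t :
  mdist x y + mdist z t <= mdist x z + mdist y t ->
  mdist x y + mdist z t <= mdist x t + mdist y z ->
  exists m n, bridge x y z t m n.
Proof.
move=> h1 h2; have [m [m1 m2 m3]] := median x y z.
have [n [n1 n2 n3]] := median z t m; exists m, n; rewrite /bridge.
have h : segment x t m /\ segment y t m.
  have := segment_distE t m2; have := segment_distE t m3.
  move: m1 m2 m3; rewrite /segment/= (metric_sym z m) => ? ? ? e1 e2.
  have := metric_triangle x m t; have := metric_triangle y m t.
  have := metric_sym m y.
  by split; [case: e1 => ?; lra | case: e2 => ?; lra].
move: h n1 n2 n3 m1 m2 m3 => [h3 h4]; rewrite !(segmentC _ m) => n1 n2 n3 m1 m2 m3.
by split => //; split; split=> //; rewrite segmentC // (segmentC z m).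
Qed.

End Tree.

(** * Shortest paths visiting a sequence of balls *)

Section Taut.
Variables (R : realType) (T : metricType R).
Hypothesis treeT : is_rtree T.
Variable r : R.
Hypothesis r0 : 0 <= r.
Implicit Types (p q s z : T) (Z : seq T).

(** The nearest-point projection of p to the closed ball of radius r about z; by [ball_projP] the
    default of [xget] is never taken. *)
Definition ball_proj z p : T :=
  xget p [set m | segment z p m /\ mdist z m = Num.min r (mdist z p)].

Lemma ball_projP z p :
  segment z p (ball_proj z p) /\ mdist z (ball_proj z p) = Num.min r (mdist z p).
Proof.
rewrite /ball_proj; case: xgetP => [m _ //|] /= nom.
have [|m zpm zm] := segment_point (a := z) (b := p)
    (r := Num.min r (mdist z p)) treeT.
  by rewrite le_min r0 mdist_ge0 ge_min lexx orbT.
by case: (nom m).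
Qed.

Lemma ball_proj_in z p : mdist z (ball_proj z p) <= r.
Proof. by have [_ ->] := ball_projP z p; rewrite ge_min lexx. Qed.

Lemma ball_proj_id z p : mdist z p <= r -> ball_proj z p = p.
Proof.
move=> zp; have [h1 h2] := ball_projP z p.
by apply: (segment_inj treeT h1 (segmentr _ _)); rewrite h2; exact/min_idPr.
Qed.

(** If p is outside the ball, its projection m is at distance exactly r from z, so a point q whose
    geodesic from p misses m would be farther than r from z. *)
Lemma ball_proj_gate z p q : mdist z q <= r ->
  mdist p q = mdist p (ball_proj z p) + mdist (ball_proj z p) q.
Proof.
move=> zq; have [zp|zp] := leP (mdist z p) r.
  by rewrite ball_proj_id// mdistxx add0r.
have [h1 h2] := ball_projP z p; rewrite (min_l (ltW zp)) in h2.
have := segment_distE treeT q h1; have := metric_triangle p (ball_proj z p) q.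
have := mdist_ge0 (ball_proj z p) q; have := metric_sym p (ball_proj z p).
have := metric_triangle p q (ball_proj z p); have := metric_sym q (ball_proj z p).
by move: h1; rewrite /segment/= => ? ? ? ? ? ? []; lra.
Qed.

Fixpoint pull p Z : T := if Z is z :: Z' then pull (ball_proj z p) Z' else p.

Fixpoint pull_cost p Z : R :=
  if Z is z :: Z' then mdist p (ball_proj z p) + pull_cost (ball_proj z p) Z'
  else 0.

(* The length of the shortest path from p to q that visits in order the balls *)
(* of radius r around the points of Z: the path that always moves as little   *)
(* as possible is shortest, because a ball of a tree is gated.                *)
Definition taut p Z q : R := pull_cost p Z + mdist (pull p Z) q.

Fixpoint visits p Z q (l : R) : Prop :=
  if Z is z :: Z' then exists2 s, mdist z s <= r & visits s Z' q (l - mdist p s)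
  else mdist p q <= l.

Lemma tautE p z Z q :
  taut p (z :: Z) q = mdist p (ball_proj z p) + taut (ball_proj z p) Z q.
Proof. by rewrite /taut/= addrA. Qed.

Lemma pull_cost_ge0 p Z : 0 <= pull_cost p Z.
Proof. by elim: Z p => //= z Z IH p; rewrite addr_ge0 ?mdist_ge0. Qed.

Lemma pull_cat p Z1 Z2 : pull p (Z1 ++ Z2) = pull (pull p Z1) Z2.
Proof. by elim: Z1 p => /=. Qed.

Lemma pull_cost_cat p Z1 Z2 :
  pull_cost p (Z1 ++ Z2) = pull_cost p Z1 + pull_cost (pull p Z1) Z2.
Proof. by elim: Z1 p => [|z Z IH] p /=; rewrite ?add0r// IH addrA. Qed.

Lemma visits_taut p Z q : visits p Z q (taut p Z q).
Proof.
elim: Z p => [|z Z IH] p; first by rewrite /taut/= add0r.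
exists (ball_proj z p); first exact: ball_proj_in.
by rewrite tautE addrAC subrr add0r.
Qed.

Lemma visits_le p Z q l l' : l <= l' -> visits p Z q l -> visits p Z q l'.
Proof.
elim: Z p l l' => [|z Z IH] p l l' ll /=; first by move/le_trans; exact.
by move=> [s zs h]; exists s => //; apply: IH h; rewrite lerD2r.
Qed.

Lemma visits_start p s Z q l : visits s Z q l -> visits p Z q (mdist p s + l).
Proof.
case: Z => [|z Z] /=; first by have := metric_triangle p s q; lra.
move=> [u zu h]; exists u => //; apply: visits_le h.
by have := metric_triangle p s u; lra.
Qed.

Lemma visits_rcons p Z s z q l :
  mdist z s <= r -> visits p Z s l -> visits p (rcons Z z) q (l + mdist s q).
Proof.
move=> zs; elim: Z p l => [|y Z IH] p l /=.
  by move=> ps; exists s => //; lra.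
by move=> [u yu /IH h]; exists u => //; rewrite addrAC.
Qed.

Lemma visits_rev p Z q l : visits p Z q l -> visits q (rev Z) p l.
Proof.
elim: Z p l => [|z Z IH] p l /=; first by rewrite metric_sym.
move=> [s zs /IH h]; rewrite rev_cons -(subrK (mdist p s) l) (metric_sym p).
by apply: visits_rcons => //; rewrite metric_sym.
Qed.

(** Rerouting a path through the gate of the first ball costs nothing; induction applies from
    there. *)
Lemma taut_min p Z q l : visits p Z q l -> taut p Z q <= l.
Proof.
elim: Z p l => [|z Z IH] p l /=; first by rewrite /taut/= add0r.
move=> [s zs h]; rewrite tautE -lerBrDl; apply: IH.
apply: visits_le (visits_start (ball_proj z p) h).
by have := ball_proj_gate p zs; lra.
Qed.

(** The greedy path is not symmetric in its ends, but its length is a minimum over paths, and paths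
    can be reversed. *)
Lemma taut_rev p Z q : taut p Z q = taut q (rev Z) p.
Proof.
apply/eqP; rewrite eq_le; apply/andP; split.
  by rewrite -{1}(revK Z); apply/taut_min/visits_rev/visits_taut.
exact/taut_min/visits_rev/visits_taut.
Qed.

Lemma pull_rcons_in p Z z : mdist z (pull p (rcons Z z)) <= r.
Proof. by rewrite -cats1 pull_cat/=; exact: ball_proj_in. Qed.

(** Both ends are pulled greedily towards the ball about z, the second one after [taut_rev]. The
    path from q enters this ball through its gate, so what remains is the distance between the two
    points of entry. *)
Lemma taut_join p Z z Z' q :
  taut p (Z ++ z :: Z') q =
  pull_cost p (rcons Z z) + pull_cost q (rcons (rev Z') z) +
  mdist (pull p (rcons Z z)) (pull q (rcons (rev Z') z)).
Proof.
rewrite -cat_rcons /taut pull_cost_cat pull_cat -!addrA; congr (_ + _).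
set s := pull p _; rewrite -/(taut s Z' q) taut_rev /taut.
rewrite -cats1 pull_cost_cat pull_cat/= addr0 -addrA; congr (_ + _).
rewrite (metric_sym s).
by apply: ball_proj_gate; exact: pull_rcons_in.
Qed.

(** For distinct gates u, v the gate property aligns p, u, v and u, v, q; two geodesics of a tree
    that overlap in a nondegenerate [u, v] glue to one. *)
Lemma ball_proj_join z p q :
  mdist p q = mdist p (ball_proj z p) + mdist q (ball_proj z q) +
              mdist (ball_proj z p) (ball_proj z q) \/
  ball_proj z p = ball_proj z q.
Proof.
have [|/eqP pq] := eqVneq (ball_proj z p) (ball_proj z q); [by right|left].
have h1 := ball_proj_gate p (ball_proj_in z q).
have h2 := ball_proj_gate q (ball_proj_in z p).
move: pq h1 h2; move: (ball_proj z p) (ball_proj z q) => u v uv h1 h2.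
have uv0 : 0 < mdist u v.
  by rewrite lt_neqAle mdist_ge0 andbT eq_sym; apply/eqP => /mdist_positivity.
have := rtree4 treeT p v u q; have := metric_triangle p u q.
have := metric_triangle u v q.
rewrite (metric_sym v u) in h2 *; rewrite (metric_sym q u) in h2.
by rewrite (metric_sym q v) in h2 *; move=> ? ? []; lra.
Qed.

(* Moving two points by the same balls either keeps them on a geodesic or     *)
(* merges them.                                                               *)
Lemma pull_join p q Z :
  mdist p q =
    pull_cost p Z + pull_cost q Z + mdist (pull p Z) (pull q Z) \/
  pull p Z = pull q Z /\ mdist p q <= pull_cost p Z + pull_cost q Z.
Proof.
elim: Z p q => [|z Z IH] p q /=; first by left; rewrite !add0r.
case: (ball_proj_join z p q) => [->|e].
  by case: (IH (ball_proj z p) (ball_proj z q)) => [->|[h1 h2]];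
    [left|right; split=> //]; lra.
right; rewrite -e; split=> //.
have := metric_triangle p (ball_proj z p) q; have := pull_cost_ge0 (ball_proj z p) Z.
by rewrite (metric_sym (ball_proj z p) q); lra.
Qed.

End Taut.

Lemma taut0 (R : realType) (T : metricType R) (treeT : is_rtree T) (p z : T) Z q :
  taut 0 p (z :: Z) q = mdist p z + taut 0 z Z q.
Proof.
rewrite tautE; have [_] := ball_projP treeT (lexx 0) z p.
by rewrite min_l ?mdist_ge0// => /mdist_positivity <-.
Qed.

(** * Dependence of the shortest length on the distances and the radius *)

Section TautStable.
Variables (R : realType) (T T' : metricType R).
Hypotheses (treeT : is_rtree T) (treeT' : is_rtree T').

Definition close_pairs (e : R) (P : seq (T * T')) : Prop :=
  {in P &, forall u v, `|mdist u.1 v.1 - mdist u.2 v.2| <= e}.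

Lemma max_close (a b c d e : R) :
  `|a - c| <= e -> `|b - d| <= e -> `|Num.max a b - Num.max c d| <= e.
Proof.
rewrite !ler_norml => /andP[h1 h2] /andP[h3 h4].
by have [|] := leP a b; have [|] := leP c d => *; apply/andP; split; lra.
Qed.

Lemma min_close (a b c d e : R) :
  `|a - c| <= e -> `|b - d| <= e -> `|Num.min a b - Num.min c d| <= e.
Proof.
rewrite !ler_norml => /andP[h1 h2] /andP[h3 h4].
by have [|] := leP a b; have [|] := leP c d => *; apply/andP; split; lra.
Qed.

Lemma ball_proj_mdist (S : metricType R) (r : R) (z p : S) :
    is_rtree S -> 0 <= r ->
  mdist p (ball_proj r z p) = mdist z p - Num.min r (mdist z p).
Proof.
move=> treeS r0; have [h <-] := ball_projP treeS r0 z p.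
by move: h; rewrite /segment/= (metric_sym (ball_proj _ _ _) p); lra.
Qed.

Lemma ball_proj_dist (S : metricType R) (r : R) (z p w : S) :
    is_rtree S -> 0 <= r ->
  mdist (ball_proj r z p) w =
  Num.max (mdist z w - Num.min r (mdist z p))
          (mdist p w - (mdist z p - Num.min r (mdist z p))).
Proof.
move=> treeS r0; have [h e] := ball_projP treeS r0 z p.
rewrite -ball_proj_mdist// -e; move: (ball_proj r z p) h {e} => m h.
have := segment_distE treeS w h.
have := metric_triangle z m w; have := metric_triangle p m w.
by move=> ? ? [] e; apply/eqP; rewrite eq_le ge_max le_max; apply/andP; split;
  [apply/orP; left | apply/andP; split | apply/orP; right | apply/andP; split]; lra.
Qed.

(** By [ball_proj_dist] one projection turns an error e into at most 3e, and the move itself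
    contributes 2e; the factor obeys C(n+1) = 2 + 3 C(n) with C(0) = 1. *)
Lemma taut_close (r r' e : R) p p' q q' (P : seq (T * T')) :
  0 <= r -> 0 <= r' -> `|r - r'| <= e -> close_pairs e [:: (p, p'), (q, q') & P] ->
  `|taut r p (unzip1 P) q - taut r' p' (unzip2 P) q'| <=
    (2 * 3 ^+ size P - 1) * e.
Proof.
move=> r0 r'0; elim: P p p' e => [|[z z'] P IH] p p' e re cl.
  have e0 : 0 <= e by apply: le_trans re.
  have := cl (p, p') (q, q'); rewrite !inE !eqxx ?orbT /= => /(_ isT isT).
  by rewrite /taut/= !add0r expr0 mulr1 => h; apply: le_trans h _; lra.
have e0 : 0 <= e by apply: le_trans re.
rewrite /= !tautE.
set m := ball_proj r z p; set m' := ball_proj r' z' p'.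
have mem u : u \in (p, p') :: (q, q') :: (z, z') :: P ->
    `|mdist p u.1 - mdist p' u.2| <= e /\ `|mdist z u.1 - mdist z' u.2| <= e.
  move=> uP; split; [apply: (cl (p, p') u) => //|apply: (cl (z, z') u) => //];
    by rewrite !inE eqxx ?orbT.
have mE u : u \in (p, p') :: (q, q') :: (z, z') :: P ->
    `|mdist m u.1 - mdist m' u.2| <= 3 * e.
  move=> uP; rewrite !ball_proj_dist//; have [pu zu] := mem u uP.
  have /= [_ zp] := mem (p, p') (mem_head _ _).
  have := min_close re zp; move: pu zu zp; rewrite !ler_norml.
  move=> /andP[? ?] /andP[? ?] /andP[? ?] /andP[? ?].
  by rewrite -ler_norml; apply: max_close; rewrite /= ler_norml; apply/andP; split; lra.
have h : `|taut r m (unzip1 P) q - taut r' m' (unzip2 P) q'| <=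
    (2 * 3 ^+ size P - 1) * (3 * e).
  apply: IH => [|u v]; first by lra.
  have sub w : w \in (q, q') :: P -> w \in (p, p') :: (q, q') :: (z, z') :: P.
    by rewrite !inE => /orP[->|->]; rewrite ?orbT.
  rewrite in_cons => /predU1P[->|uP]; rewrite in_cons => /predU1P[->|vP] /=.
  - by rewrite !mdistxx subrr normr0; lra.
  - exact/mE/sub.
  - by rewrite metric_sym (metric_sym _ m'); exact/mE/sub.
  - apply: le_trans (cl u v _ _) _; try exact: sub.
    by lra.
have ea : `|mdist p m - mdist p' m'| <= 2 * e.
  have /= [_ zp] := mem (p, p') (mem_head _ _).
  rewrite !ball_proj_mdist//; have := min_close re zp; move: zp.
  by rewrite !ler_norml => /andP[? ?] /andP[? ?]; apply/andP; split; lra.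
rewrite (_ : (2 * 3 ^+ (size P).+1 - 1) * e =
    2 * e + (2 * 3 ^+ size P - 1) * (3 * e)); last by rewrite exprS; lra.
rewrite opprD addrACA; apply: le_trans (ler_normD _ _) _; exact: lerD.
Qed.

End TautStable.

(** * Isometric pieces of a morphism *)

Lemma lipschitz_isometric_sub (R : realType) (T Y : metricType R) (f : T -> Y)
    (a c x y : T) : (forall u v, mdist (f u) (f v) <= mdist u v) ->
  mdist (f a) (f c) = mdist a c ->
  segment a c x -> segment x c y -> mdist (f x) (f y) = mdist x y.
Proof.
rewrite /segment/= => lip ac acx xcy.
have := lip a x; have := lip x y; have := lip y c.
have := metric_triangle (f a) (f x) (f c).
have := metric_triangle (f x) (f y) (f c); lra.
Qed.

Section Pieces.
Variables (R : realType) (T Y : metricType R) (f : T -> Y).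
Hypotheses (treeT : is_rtree T) (treeY : is_rtree Y).
Hypothesis morf : is_morphism f.
Implicit Types (a b c x y z : T) (p q : Y).

Let lip := morphism_lipschitz treeT morf.

Lemma isometric_sub a c x y : mdist (f a) (f c) = mdist a c ->
  segment a c x -> segment x c y -> mdist (f x) (f y) = mdist x y.
Proof. exact: lipschitz_isometric_sub. Qed.

Lemma isometric_segment a c x : mdist (f a) (f c) = mdist a c ->
  segment a c x -> segment (f a) (f c) (f x) /\ mdist (f a) (f x) = mdist a x.
Proof.
rewrite /segment/= => ac acx.
have := lip a x; have := lip x c; have := metric_triangle (f a) (f x) (f c).
by move=> *; split; lra.
Qed.

Lemma isometric_lift a c q : mdist (f a) (f c) = mdist a c ->
  segment (f a) (f c) q -> exists2 x, segment a c x & f x = q.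
Proof.
move=> ac acq.
have [|x acx ax] := segment_point (a := a) (b := c) (r := mdist (f a) q) treeT.
  by move: acq; rewrite /segment/= mdist_ge0/= => h; have := mdist_ge0 q (f c); lra.
exists x => //; have [h1 h2] := isometric_segment ac acx.
by apply: (segment_inj treeY h1 acq); rewrite h2.
Qed.

(** Comparing endpoints is enough: f is 1-Lipschitz, so it is then isometric on the whole piece
    ([isometric_sub]). *)
Fixpoint pieces n a b : Prop :=
  if n is n'.+1 then
    exists c, [/\ segment a b c, mdist (f a) (f c) = mdist a c & pieces n' c b]
  else a = b.

Lemma pieces_sub n a b y : pieces n a b -> segment a b y -> pieces n y b.
Proof.
elim: n a y => [|n IH] a y /=.
  move=> <-; rewrite /segment/= mdistxx => h; apply: mdist_eq0_le.
  by have := mdist_ge0 a y; lra.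
move=> [c [abc ac cb]] aby; have [h|h] := segment_split treeT abc aby.
  exists c; split => //.
    by move: h abc aby; rewrite /segment/=; tri a y b; tri a c b; tri y c b; tri a y c; lra.
  by apply: isometric_sub ac h (segmentr _ _).
by exists y; split; [exact: segmentl | rewrite !mdistxx | exact: IH h].
Qed.

Let away_pieces a (s : seq (T * T)) :
  (forall u, u \in s -> ~ segment u.1 u.2 a) ->
  exists2 e, 0 < e & forall z u, u \in s -> mdist a z < e -> ~ segment u.1 u.2 z.
Proof.
elim: s => [|u s IH] h; first by exists 1.
have [|e e0 he] := IH; first by move=> v vs; apply: h; rewrite inE vs orbT.
pose d := (mdist u.1 a + mdist a u.2 - mdist u.1 u.2) / 2.
have d0 : 0 < d.
  rewrite divr_gt0// subr_gt0 lt_neqAle metric_triangle andbT.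
  by apply/eqP => /esym; apply: h; rewrite inE eqxx.
exists (Num.min d e); first by rewrite lt_min d0.
move=> z v; rewrite inE lt_min => /predU1P[->|vs] /andP[az1 az2]; last exact: he.
move: az1; rewrite /segment/= /d; tri u.1 a z; tri a z u.2; lra.
Qed.

(** Walk greedily: take a segment u of the cover through a, go to the last point c of [a, b] in u,
    and discard u. The starting point is exempt from the covering condition because c may lie in u
    alone. *)
Let pieces_cover n (s : seq (T * T)) a b : (size s <= n)%N ->
  (forall u, u \in s -> {in segment u.1 u.2 &, forall x y,
      mdist (f x) (f y) = mdist x y}) ->
  (forall z, segment a b z -> a <> z ->
     exists2 u, u \in s & segment u.1 u.2 z) ->
  exists n, pieces n a b.
Proof.
elim: n s a => [|n IH] s a ns isof cover.
  move: ns; rewrite leqn0 => /nilP s0; exists 0%N => /=; apply: contrapT => ab.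
  by have [u] := cover b (segmentr _ _) ab; rewrite s0.
have [ab|ab] := pselect (a = b); first by exists 0%N.
(* Finitely many segments that miss a keep a positive distance from it, so points of [a, b] close to
   a would be uncovered. *)
have [u us ua] : exists2 u, u \in s & segment u.1 u.2 a.
  apply: contrapT => nou.
  have [|e e0 he] := @away_pieces a s; first by move=> u us ua; apply: nou; exists u.
  have ab0 : 0 < mdist a b.
    rewrite lt_neqAle mdist_ge0 andbT; apply/eqP => /esym/mdist_positivity.
    exact: ab.
  have [|z abz az] := segment_point (a := a) (b := b)
      (r := Num.min (mdist a b) (e / 2)) treeT.
    by rewrite le_min mdist_ge0 ge_min lexx /=; lra.
  have az0 : 0 < mdist a z by rewrite az lt_min ab0 divr_gt0.
  have [v vs vz] : exists2 u, u \in s & segment u.1 u.2 z.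
    by apply: cover => // azE; rewrite azE mdistxx ltxx in az0.
  apply: (he z v vs) => //; rewrite az gt_min; apply/orP; right; lra.
have [m1 [m11 m12 m13]] := median treeT a b u.1.
have [m2 [m21 m22 m23]] := median treeT a b u.2.
have far z : segment a b z -> segment u.1 u.2 z ->
    mdist a z <= mdist a m1 \/ mdist a z <= mdist a m2.
  move=> abz uz; have [h|h] := segment_split treeT ua uz; [left|right].
    move: m11 m12 m13 abz h; rewrite /segment/=; tri u.1 z a; tri a z b.
    by tri u.1 z b; tri b m1 u.1; tri a m1 b; tri u.1 m1 a; lra.
  move: m21 m22 m23 abz h; rewrite /segment/=; tri u.2 z a; tri a z b.
  by tri u.2 z b; tri b m2 u.2; tri a m2 b; tri u.2 m2 a; lra.
have [c [abc uc fc]] : exists c, [/\ segment a b c, segment u.1 u.2 c &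
    forall z, segment a b z -> segment u.1 u.2 z -> mdist a z <= mdist a c].
  have um1 : segment u.1 u.2 m1.
    by apply: (segment_convex treeT (segmentl _ _) ua); rewrite segmentC.
  have um2 : segment u.1 u.2 m2.
    by apply: (segment_convex treeT ua (segmentr _ _)).
  have [h|h] := leP (mdist a m1) (mdist a m2); [exists m2|exists m1];
    split=> // z abz /(far z abz).
    by case=> // /le_trans; apply.
  by case=> // /le_trans; apply; exact: ltW.
have [|||k hk] := IH [seq v <- s | v != u] c.
- rewrite size_filter; move: us ns; rewrite -has_pred1 has_count -(count_predC (pred1 u) s).
  by case: (count (pred1 u) s) => // k _; rewrite addSn ltnS; apply: leq_trans;
    exact: leq_addl.
- by move=> p; rewrite mem_filter => /andP[_]; exact: isof.
- move=> z cbz cz; have [abz acz] := segment_trans abc cbz.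
  have az : a <> z.
    move=> az; apply: cz; rewrite -az in cbz acz *.
    apply/esym/mdist_eq0_le; move: acz.
    by rewrite /segment/= (metric_sym c); tri a c a; rewrite mdistxx; lra.
  have [v vs vz] := cover z abz az; exists v => //; rewrite mem_filter vs andbT.
  apply/eqP => vu; rewrite vu in vz; apply: cz; apply: mdist_eq0_le.
  by have := fc z abz vz; move: acz cbz abc; rewrite /segment/=; tri a c z; lra.
exists k.+1, c; split => //; first by apply: (isof u); rewrite ?inE.
Qed.

Lemma pieces_exist a b : exists n, pieces n a b.
Proof.
have [s sE isof] := morf a b; apply: (pieces_cover (leqnn _) isof) => z abz _.
by move: abz; rewrite sE => -[u us uz]; exists u.
Qed.

(** An intermediate value argument: the image path can leave the part of the tree that q separates
    from p only through q. A piece either contains the first passage or maps entirely into that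
    part. *)
Lemma first_hit_or n a b p q : pieces n a b -> segment (f a) p q ->
  (forall z, segment a b z -> segment (f z) p q) \/
  exists y, [/\ segment a b y, f y = q &
    forall z, segment a y z -> segment (f z) p q].
Proof.
elim: n a => [|n IH] a /=.
  move=> <- apq; left=> z; rewrite /segment/= mdistxx => h.
  suff <- : a = z by []; apply: mdist_eq0_le; have := mdist_ge0 z a; lra.
move=> [c [abc ac cb]] apq; have [acq|acq] := pselect (segment (f a) (f c) q).
  have [y acy yq] := isometric_lift ac acq.
  right; exists y; split=> //; first by have [] := segment_transl abc acy.
  move=> z ayz; have [acz _] := segment_transl acy ayz.
  have [_ az] := isometric_segment ac acz; have [_ ay] := isometric_segment ac acy.
  move: ayz apq; rewrite -yq /segment/=; have := lip z y.
  by have := metric_triangle (f z) (f y) p; have := metric_triangle (f a) (f z) p; lra.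
have beyond z : segment a c z -> segment (f z) p q.
  move=> acz; have [h _] := isometric_segment ac acz.
  have [|//] := segment_cover treeY (f z) apq => h2; case: acq.
  by have [] := segment_transl h h2.
have [h|[y [h1 h2 h3]]] := IH c cb (beyond _ (segmentr _ _)); [left|right].
  by move=> z /(segment_cover treeT c)[/beyond|/h].
exists y; split=> //; first by have [] := segment_trans abc h1.
by move=> z /(segment_cover treeT c)[/beyond|/h3].
Qed.

Lemma first_hit a b q : segment (f a) (f b) q ->
  exists y, [/\ segment a b y, f y = q &
    forall z, segment a y z -> segment (f z) (f b) q].
Proof.
have [n ab] := pieces_exist a b.
case/(first_hit_or ab) => // h; exists b; split=> //; first exact: segmentr.
have := h b (segmentr _ _); rewrite /segment/= mdistxx => e.
by apply: mdist_eq0_le; have := mdist_ge0 q (f b); lra.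
Qed.

Lemma last_hit a b q : segment (f a) (f b) q ->
  exists y, [/\ segment a b y, f y = q &
    forall z, segment y b z -> segment (f a) (f z) q].
Proof.
rewrite segmentC => /first_hit[y [h1 h2 h3]]; exists y; split=> //.
  by rewrite segmentC.
by move=> z; rewrite segmentC (segmentC (f a)); exact: h3.
Qed.

End Pieces.

(** * Ordered subdivisions of a segment *)

Section Chains.
Variables (R : realType) (T : metricType R) (step : T -> T -> Prop).
Implicit Types (a b c m : T) (W : seq T).

Fixpoint chain a W b : Prop :=
  if W is c :: W' then [/\ segment a b c, step a c & chain c W' b]
  else step a b.

Lemma chain_cat a m b W W' : segment a b m ->
  chain a W m -> chain m W' b -> chain a (W ++ m :: W') b.
Proof.
elim: W a => [|c W IH] a abm /=; first by split.
move=> [amc ac cm] mb; have [abc cbm] := segment_transl abm amc.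
by split=> //; exact: IH.
Qed.

Lemma chain_rev a b W : (forall x y, step x y -> step y x) ->
  chain a W b -> chain b (rev W) a.
Proof.
move=> sym; elim: W a => [|c W IH] a /=; first exact: sym.
move=> [abc ac /IH cb]; rewrite rev_cons -cats1; apply: chain_cat => //=.
  by rewrite segmentC.
exact: sym.
Qed.

End Chains.

Section FineChains.
Variables (R : realType) (T Y : metricType R) (f : T -> Y).
Hypotheses (treeT : is_rtree T) (treeY : is_rtree Y).
Hypothesis morf : is_morphism f.

(** At r = 0 finitely many steps cannot obey a length bound; there isometry alone yields the
    formula, by [taut0_chain]. *)
Definition fine_step (r : R) (x y : T) : Prop :=
  mdist (f x) (f y) = mdist x y /\ (r = 0 \/ mdist x y <= r).

Lemma fine_step_sym r x y : fine_step r x y -> fine_step r y x.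
Proof. by rewrite /fine_step !(metric_sym y) !(metric_sym (f y)). Qed.

Lemma fine_chain_exists r a b : 0 <= r ->
  exists W, chain (fine_step r) a W b.
Proof.
rewrite le_eqVlt => r0; have [n] := pieces_exist treeT morf a b.
elim: n a => [|n IH] a /=.
  move=> ->; exists [::]; rewrite /= /fine_step !mdistxx; split=> //.
  by case/predU1P: r0 => [<-|/ltW]; [left|right].
move=> [c [abc ac /IH[W' cb]]].
suff [W ac'] : exists W, chain (fine_step r) a W c.
  by exists (W ++ c :: W'); exact: chain_cat.
case/predU1P: r0 => [<-|r0]; first by exists [::]; split=> //; left.
have [k hk] : exists k, mdist a c <= k%:R * r.
  exists (Num.trunc (mdist a c / r)).+1; rewrite -ler_pdivrMr//.
  by apply: ltW; rewrite truncnS_gt.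
elim: k a {abc} ac hk => [|k IHk] a ac hk.
  have ? := mdist_ge0 a c; exists [::]; split=> //; right; lra.
have [h|h] := leP (mdist a c) r; first by exists [::]; split => //; right.
have [|x acx ax] := segment_point (a := a) (b := c) (r := r) treeT.
  by rewrite !ltW.
have [_ ax'] := isometric_segment treeT morf ac acx.
have xc := isometric_sub treeT morf ac acx (segmentr _ _).
have [|W xW] := IHk x xc.
  by move: acx hk; rewrite /segment/= ax -natr1; lra.
exists (x :: W) => /=; split => //; split; first by [].
by right; rewrite ax.
Qed.

End FineChains.

(** * The formula for the distance of T_t *)

Section MonotoneChains.
Variables (R : realType) (T Y : metricType R) (f : T -> Y) (r : R).
Hypotheses (treeT : is_rtree T) (treeY : is_rtree Y).
Hypothesis lip : forall a b, mdist (f a) (f b) <= mdist a b.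
Hypothesis r0 : 0 <= r.
Implicit Types (a b m x y : T) (W : seq T).

Definition monotone_chain := chain (fun _ _ : T => True).

Lemma chain_monotone st a W b : chain st a W b -> monotone_chain a W b.
Proof. by elim: W a => //= c W IH a [? ? /IH]. Qed.

Lemma monotone_in a W b w : monotone_chain a W b -> w \in W -> segment a b w.
Proof.
elim: W a => //= c W IH a [abc _ cb]; rewrite inE => /predU1P[->//|/(IH _ cb) h].
by have [] := segment_trans abc h.
Qed.

Lemma monotone_split a W b m : monotone_chain a W b -> segment a b m ->
  exists W1 W2, [/\ W = W1 ++ W2, monotone_chain a W1 m & monotone_chain m W2 b].
Proof.
elim: W a => [|c W IH] a /=; first by exists [::], [::].
move=> [abc _ cb] abm; have [h|h] := segment_split treeT abm abc; last first.
  by exists [::], (c :: W).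
have [_ cbm] := segment_transl abm h.
have [|W1 [W2 [-> h1 h2]]] := IH c cb; first by rewrite segmentC in cbm *.
by exists (c :: W1), W2.
Qed.

Lemma monotone_start y a W b : segment y b a -> monotone_chain a W b -> monotone_chain y W b.
Proof.
case: W => //= c W yba [abc _ cb]; split => //.
by have [] := segment_trans yba abc.
Qed.

Lemma visits_stay p q W1 W2 l : (forall w, w \in W1 -> mdist (f w) p <= r) ->
  visits r p (map f W2) q l -> visits r p (map f (W1 ++ W2)) q l.
Proof.
move=> + h; elim: W1 => //= w W1 IH hW; exists p; first by rewrite hW ?mem_head.
by rewrite mdistxx subr0; apply: IH => v vW; apply: hW; rewrite inE vW orbT.
Qed.

Lemma visits_walk q x m W1 W2 l : monotone_chain x W1 m ->
  visits r (f m) (map f W2) q l ->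
  visits r (f x) (map f (W1 ++ W2)) q (mdist x m + l).
Proof.
move=> + h; elim: W1 x => [|c W1 IH] x /=.
  by move=> _; apply: visits_le (visits_start _ h); rewrite lerD2r.
move=> [xmc _ /IH cm]; exists (f c); first by rewrite mdistxx.
by apply: visits_le cm; have := lip x c; move: xmc; rewrite /segment/=; lra.
Qed.

End MonotoneChains.

Lemma taut0_chain (R : realType) (T Y : metricType R) (f : T -> Y) (r : R) a W b :
  is_rtree Y -> chain (fine_step f r) a W b ->
  taut 0 (f a) (map f W) (f b) = mdist a b.
Proof.
move=> treeY; elim: W a => [|c W IH] a /=; first by rewrite /taut/= add0r => -[->].
by move=> [acb [ac _] /IH e]; rewrite taut0// ac e.
Qed.

Section FoldDistance.
Variables (R : realType) (G : groupType) (f : gmor R G) (t : ext_nonneg R).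
Variable r : R.
Hypothesis tr : val t = r%:E.
Implicit Types (a b w x y z : gsource f) (W : seq (gsource f)).

Let treeT := gmor_source f.
Let treeY := gmor_target f.
Let morf := @gmor_morph _ _ f.
Let lip := morphism_lipschitz treeT morf.

Lemma level_ge0 : 0 <= r.
Proof. by have : (0 <= val t)%E := set_valP t; rewrite tr lee_fin. Qed.

Lemma fold_relF a b : fold_rel t a b <->
  f a = f b /\ forall x, segment a b x -> mdist (f x) (f a) <= r.
Proof.
by split=> [/fold_relE|] [fab h]; last apply/fold_relE; split=> // x /h;
  rewrite tr lee_fin.
Qed.

Lemma fold_dist_mdist a b : fold_dist t a b <= mdist a b.
Proof.
apply: le_trans (fold_dist_le (s := [:: (a, b)]) _) _.
  by split; exact: fold_rel_refl.
by rewrite /subdivision_length big_seq1.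
Qed.

Lemma mdist_fold_dist a b : mdist (f a) (f b) <= fold_dist t a b.
Proof.
apply/ler_addgt0Pl => e /(fold_dist_adherent t a b)[s /subdivision_bound[h _]].
by lra.
Qed.

(** Where f turns back, its detour off [f a, f w] starts and ends at one point m and is separated
    from f w by m. Its points are thus no farther from m than from f w, hence within r of m, and ~_t
    collapses the detour. *)
Lemma fold_dist_near a w :
  (forall z, segment a w z -> mdist (f z) (f w) <= r) ->
  fold_dist t a w <= mdist (f a) (f w).
Proof.
have [n] := pieces_exist treeT morf a w; elim: n a => [|n IH] a /=.
  by move=> -> _; rewrite fold_dist_rel ?mdistxx//; exact: fold_rel_refl.
move=> [c [awc ac cw]] near_w.
have [m [acm cwm awm]] := median treeY (f a) (f c) (f w).
have [a1 aca1 fa1] := isometric_lift treeT treeY morf ac acm.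
have [a2 [cwa2 fa2 beyond]] := first_hit treeT treeY morf cwm.
have [awa1 _] := segment_transl awc aca1; have [awa2 _] := segment_trans awc cwa2.
have rel12 : fold_rel t a1 a2.
  apply/fold_relF; split; first by rewrite fa1.
  move=> x /(segment_cover treeT c) xs.
  have [awx wm] : segment a w x /\ segment (f x) (f w) m.
    case: xs => xs; last first.
      have [cwx _] := segment_transl cwa2 xs.
      by have [awx _] := segment_trans awc cwx; split=> //; exact: beyond.
    have [acx h] := segment_trans aca1 xs; have [awx _] := segment_transl awc acx.
    split=> //; have fc1 := isometric_sub treeT morf ac aca1 (segmentr _ _).
    have [h1 _] := isometric_segment treeT morf fc1 xs; rewrite fa1 in h1.
    move: h1 cwm; rewrite /segment/=; tri m (f x) (f c).
    by tri (f x) m (f w); tri (f c) (f x) (f w); tri (f c) m (f w); lra.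
  rewrite fa1; have := near_w x awx; move: wm; rewrite /segment/=.
  by have := mdist_ge0 m (f w); lra.
have := IH a2 (pieces_sub treeT morf cw cwa2).
have := fold_dist_triangle t a1 a w; have := fold_dist_triangle t a2 a1 w.
have := fold_dist_mdist a a1; rewrite (fold_dist_rel rel12) fa2.
have [_ <-] := isometric_segment treeT morf ac aca1; rewrite fa1.
move: awm; rewrite /segment/= => awm h1 h2 h3 h4.
suff /h4 : forall z, segment a2 w z -> mdist (f z) (f w) <= r by lra.
by move=> z a2wz; apply: near_w; have [] := segment_trans awa2 a2wz.
Qed.

(* One move of the greedy path at f y, lifted to T_0. Small steps ensure that   *)
(* the move is at most r, as fold_dist_near requires.                          *)
Let follow y x x' : 0 < r -> segment y x' x ->
  (forall z, segment y x z -> mdist (f z) (f y) <= r) ->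
  mdist (f x) (f x') = mdist x x' -> mdist x x' <= r ->
  exists y', [/\ f y' = ball_proj r (f x') (f y), segment y x' y',
    fold_dist t y y' <= mdist (f y) (f y') &
    forall z, segment y' x' z -> mdist (f z) (f y') <= r].
Proof.
move=> r0 yx'x near_y xx' xr.
have [h|h] := leP (mdist (f x') (f y)) r.
  exists y; rewrite (ball_proj_id treeY (ltW r0) h); split=> //.
  - exact: segmentl.
  - by rewrite fold_dist_rel ?mdist_ge0//; exact: fold_rel_refl.
  - move=> z /(segment_cover treeT x)[/near_y//|xx'z].
    have [h1 _] := isometric_segment treeT morf xx' xx'z.
    rewrite metric_sym; apply: (segment_ball treeY h1); last by rewrite metric_sym.
    by rewrite metric_sym; apply: near_y; exact: segmentr.
have [h1 h2] := ball_projP treeY (ltW r0) (f x') (f y).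
rewrite (min_l (ltW h)) in h2; move: (ball_proj r (f x') (f y)) h1 h2 => q.
rewrite segmentC => yx'q x'q.
(* Past the last point over q, the image lies on the side of q away from f y, so it is no farther
   from q than from f y. *)
have [y' [yx'y' fy' beyond]] := last_hit treeT treeY morf yx'q.
have near_y' z : segment y' x' z -> segment y x z -> mdist (f z) q <= r.
  move=> /beyond + /near_y; rewrite /segment/= (metric_sym q) (metric_sym (f y) (f z)).
  by have := mdist_ge0 (f y) q; lra.
exists y'; split=> //; last first.
  move=> z y'x'z; rewrite fy'; have [h1 h2] := segment_trans yx'y' y'x'z.
  have [yxz|xx'z] := segment_split treeT yx'x h1; first exact: near_y'.
  have [fz _] := isometric_segment treeT morf xx' xx'z.
  have [yxy'|xx'y'] := segment_split treeT yx'x yx'y'.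
    rewrite metric_sym; apply: (segment_ball treeY fz); last by rewrite metric_sym x'q.
    rewrite metric_sym; apply: near_y'; last exact: segmentr.
    by have [_ h3] := segment_transl yx'x yxy'.
  have y'x' := isometric_sub treeT morf xx' xx'y' (segmentr _ _).
  have [h3 _] := isometric_segment treeT morf y'x' y'x'z.
  rewrite -fy' metric_sym; apply: (segment_ball treeY h3).
    by rewrite mdistxx ltW.
  by rewrite fy' metric_sym x'q.
rewrite fold_dist_sym metric_sym; apply: fold_dist_near => z; rewrite segmentC => yy'z.
have [yxy'|xx'y'] := segment_split treeT yx'x yx'y'.
  by apply: near_y; have [] := segment_transl yxy' yy'z.
have [yx'z _] := segment_transl yx'y' yy'z.
have [yxz|xx'z] := segment_split treeT yx'x yx'z; first exact: near_y.
have [_ y'xz] : segment x x' y' /\ segment x y' z.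
  split=> //; move: xx'y' xx'z yy'z yx'x; rewrite /segment/=.
  by tri x y' z; tri y z x'; tri y y' x'; tri y z x; tri y x y'; lra.
have [h1 _] := isometric_segment treeT morf xx' xx'y'.
have xy' : mdist (f x) (f y') = mdist x y'.
  by have [] := isometric_segment treeT morf xx' xx'y'.
have [h3 _] := isometric_segment treeT morf xy' y'xz.
rewrite metric_sym; apply: (segment_ball treeY h3).
  by rewrite metric_sym; apply: near_y; exact: segmentr.
rewrite fy'; move: yx'q; rewrite /segment/= (metric_sym q) x'q => e.
have := metric_triangle (f y) (f x) (f x'); rewrite xx'.
have := near_y x (segmentr _ _); rewrite (metric_sym (f x)); lra.
Qed.

Lemma fold_dist_le_taut a W b : chain (fine_step f r) a W b ->
  fold_dist t a b <= taut r (f a) (map f W) (f b).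
Proof.
move=> aWb; have := level_ge0; rewrite le_eqVlt => /predU1P[r0|r0].
  rewrite -r0 (taut0_chain treeY aWb); exact: fold_dist_mdist.
(* Invariant: f y is the current point of the greedy path, x is the last chain point passed, and f
   maps [y, x] into the ball of radius r about f y. *)
suff H y x : segment y b x ->
    (forall z, segment y x z -> mdist (f z) (f y) <= r) ->
    chain (fine_step f r) x W b ->
    fold_dist t y b <= taut r (f y) (map f W) (f b).
  apply: (H a a) => //; first exact: segmentl.
  move=> z; rewrite /segment/= mdistxx => h.
  have <- : a = z by apply: mdist_eq0_le; have := mdist_ge0 z a; lra.
  by rewrite mdistxx ltW.
have rN0 : r <> 0 by move=> e; rewrite e ltxx in r0.
elim: W {aWb} y x => [|c W IH] y x ybx near_y /=.
  move=> [xb [//|xr]]; have [y' [h1 h2 h3 h4]] := follow r0 ybx near_y xb xr.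
  (* A final ball about f b is added at no cost, the path to its centre passing through its gate. *)
  rewrite /taut/= add0r (@ball_proj_gate _ _ treeY r level_ge0 (f b) (f y)); last first.
    by rewrite mdistxx ltW.
  rewrite -h1; apply: le_trans (fold_dist_triangle _ y' _ _) _; rewrite lerD//.
  rewrite fold_dist_sym metric_sym; apply: fold_dist_near => z.
  by rewrite segmentC; exact: h4.
move=> [xbc [xc [//|xr]] cb].
have [ybc ycx] : segment y b c /\ segment y c x by exact: segment_trans.
have [y' [h1 h2 h3 h4]] := follow r0 ycx near_y xc xr.
rewrite tautE -h1; apply: le_trans (fold_dist_triangle _ y' _ _) _; rewrite lerD//.
apply: (IH y' c) => //.
by have [_] := segment_transl ybc h2.
Qed.

(** On a jump from a to x, the chain points on [a, x] have images within r of f a and are visited by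
    standing still; on a move from x to y, those on [x, y] are visited along f. Medians with b tell
    which part of the chain each step accounts for. *)
Let subdivision_visits a s b W : subdivision t a s b -> monotone_chain a W b ->
  visits r (f a) (map f W) (f b) (subdivision_length s).
Proof.
elim: s a W => [|[x y] s IH] a W /=.
  move=> /fold_relF[fab near_a] aWb; rewrite -(cats0 W); apply: visits_stay.
    by move=> w /(monotone_in aWb); exact: near_a.
  by rewrite /= /subdivision_length big_nil fab mdistxx.
move=> [ax ysb] aWb; have [m [axm xbm abm]] := median treeT a x b.
have [W1 [W2 [-> h1 h2]]] := monotone_split treeT aWb abm.
have [fax near_a] := (fold_relF _ _).1 ax.
apply: visits_stay.
  move=> w /(monotone_in h1) amw; apply: near_a.
  by have [] := segment_transl axm amw.
rewrite fax /subdivision_length big_cons /= -/(subdivision_length s).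
have {}h2 := monotone_start xbm h2; move: W2 h2 {W aWb W1 h1} => W xWb.
have [m' [h1 h2 h3]] := median treeT x y b.
have [W1 [W2 [-> xW1 W2b]]] := monotone_split treeT xWb h3.
apply: visits_le (visits_walk lip level_ge0 xW1 (visits_start _ (IH y W2 ysb _))).
  by move: h1; rewrite /segment/=; have := lip m' y; lra.
by apply: monotone_start W2b.
Qed.

Lemma taut_le_fold_dist a W b : monotone_chain a W b ->
  taut r (f a) (map f W) (f b) <= fold_dist t a b.
Proof.
move=> aWb; apply/ler_addgt0Pl => e /(fold_dist_adherent t a b)[s abs se].
have := taut_min treeY level_ge0 (subdivision_visits abs aWb); lra.
Qed.

Lemma fold_distE a W b : chain (fine_step f r) a W b ->
  fold_dist t a b = taut r (f a) (map f W) (f b).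
Proof.
move=> aWb; apply/eqP; rewrite eq_le fold_dist_le_taut//.
exact/taut_le_fold_dist/chain_monotone/aWb.
Qed.

End FoldDistance.

(** * T_t is an R-tree *)

Section TreeSegments.
Variables (R : realType) (T : metricType R).
Hypothesis treeT : is_rtree T.
Implicit Types a b c d m p z : T.

Lemma median_gate a b p m z : segment a b m -> segment p a m -> segment p b m ->
  segment a b z -> segment p z m.
Proof.
move=> abm pam pbm abz; have [h|h] := segment_split treeT abm abz.
  by rewrite segmentC in h; have [] := segment_trans pam h.
by have [] := segment_trans pbm h.
Qed.

(** The ends u and v are the projections of c and d to [a, b]. *)
Lemma segmentI a b c d z0 : segment a b z0 -> segment c d z0 ->
  exists u v, segment a b `&` segment c d = segment u v.
Proof.
move=> abz0 cdz0; have [u [h1 h2 h3]] := median treeT c a b.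
have [v [k1 k2 k3]] := median treeT d a b; exists u, v.
have cu z : segment a b z -> segment c z u by exact: median_gate.
have dv z : segment a b z -> segment d z v by exact: median_gate.
have [cdu _] := segment_transl cdz0 (cu _ abz0).
have [dcv _] : segment d c v /\ segment v c z0.
  by apply: segment_transl (dv _ abz0); rewrite segmentC.
apply/seteqP; split=> z; last first.
  move=> uvz; split; first exact: (segment_convex treeT h2 k2).
  by apply: (segment_convex treeT cdu _ uvz); rewrite segmentC.
move=> [/= abz cdz]; have := cu _ abz; have := dv _ abz.
move: cdz cdu; rewrite /segment/=.
tri c u z; tri d v z; tri c z d; tri u z v; tri c u v; tri c v d; tri u v d.
by lra.
Qed.

End TreeSegments.

Section FoldTree.
Variables (R : realType) (G : groupType) (f : gmor R G) (t : ext_nonneg R).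
Variable r : R.
Hypothesis tr : val t = r%:E.
Implicit Types (a b c m n w x y z : gsource f) (A B M : seq (gsource f)).

Let treeT := gmor_source f.
Let treeY := gmor_target f.
Let morf := @gmor_morph _ _ f.
Let r0 := level_ge0 tr.

Lemma fold_dist_via a b m A B : segment a b m ->
  chain (fine_step f r) a A m -> chain (fine_step f r) b B m ->
  fold_dist t a b =
    pull_cost r (f a) (map f (rcons A m)) + pull_cost r (f b) (map f (rcons B m)) +
    mdist (pull r (f a) (map f (rcons A m))) (pull r (f b) (map f (rcons B m))).
Proof.
move=> abm aAm bBm.
have mBb := chain_rev (@fine_step_sym _ _ _ f r) bBm.
rewrite (fold_distE tr (chain_cat abm aAm mBb)) map_cat/= taut_join//.
by rewrite map_rev revK !map_rcons.
Qed.

(** Pull x and y across the bridge by the same balls. By [pull_join] they either stay on a geodesic,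
    and the four-point condition of T_oo applies to the points reached, or merge, and then S2 = S3.
    All three inequalities are stated since the bridge in T_0 may pair the points in any of three
    ways. *)
Lemma bridge_fold_dist x y z w m n (S1 := fold_dist t x y + fold_dist t z w)
    (S2 := fold_dist t x z + fold_dist t y w)
    (S3 := fold_dist t x w + fold_dist t y z) :
  bridge x y z w m n ->
  [/\ S1 <= Num.max S2 S3, S2 <= Num.max S1 S3 & S3 <= Num.max S1 S2].
Proof.
move=> [xym zwn [[xzm mzn] [xwm mwn] [yzm _] [ywm _]]].
have ch := fine_chain_exists treeT morf _ _ r0.
have [A xA] := ch x m; have [A' yA] := ch y m; have [M mM] := ch m n.
have [B zB] := ch z n; have [B' wB] := ch w n.
have via u C v D : segment u v m -> segment m v n ->
    chain (fine_step f r) u C m -> chain (fine_step f r) v D n ->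
    fold_dist t u v = pull_cost r (f u) (map f (rcons C m)) +
      pull_cost r (pull r (f u) (map f (rcons C m))) (map f (rcons M n)) +
      pull_cost r (f v) (map f (rcons D n)) +
      mdist (pull r (pull r (f u) (map f (rcons C m))) (map f (rcons M n)))
        (pull r (f v) (map f (rcons D n))).
  move=> uvm mvn uC vD; have [uvn unm] := segment_trans uvm mvn.
  rewrite (fold_dist_via uvn (chain_cat unm uC mM) vD) rcons_cat/= -cat_rcons.
  by rewrite map_cat pull_cost_cat pull_cat.
rewrite /S1 /S2 /S3 (fold_dist_via xym xA yA) (fold_dist_via zwn zB wB).
rewrite (via x A z B)// (via x A w B')// (via y A' z B)// (via y A' w B')//.
move: (pull_cost _ (f x) _) (pull_cost _ (f y) _) => cx cy.
move: (pull_cost _ (f z) _) (pull_cost _ (f w) _) => cz cw.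
move: (pull _ (f x) _) (pull _ (f y) _) => p q.
move: (pull _ (f z) _) (pull _ (f w) _) => u v.
have := pull_join treeY r0 p q (map f (rcons M n)).
move: (pull_cost _ p _) (pull_cost _ q _) => cp cq.
move: (pull _ p _) (pull _ q _) => p' q' [->|[<- pq]].
  have := rtree4 treeY p' q' u v; have := rtree4 treeY p' u q' v.
  have := rtree4 treeY p' v q' u; rewrite (metric_sym u q') (metric_sym v q').
  rewrite (metric_sym v u) !le_max => h1 h2 h3.
  split; apply/orP; [case: h3|case: h2|case: h1] => ?; try by [left; lra|right; lra].
rewrite !le_max; split; apply/orP; [left|right|right]; try lra.
have := metric_triangle u p' v; rewrite (metric_sym u p'); lra.
Qed.

Lemma fold_dist_hyperbolic x y z w :
  fold_dist t x y + fold_dist t z w <=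
    Num.max (fold_dist t x z + fold_dist t y w) (fold_dist t x w + fold_dist t y z).
Proof.
have := rtree4 treeT x y z w; have := rtree4 treeT x z y w.
have := rtree4 treeT x w y z.
rewrite (metric_sym z y) (metric_sym w y) (metric_sym w z) => h1 h2 h3.
have [] : [\/ exists m n, bridge x y z w m n, exists m n, bridge x z y w m n |
  exists m n, bridge x w y z m n].
  have [k1|k1] := leP (mdist x y + mdist z w) (mdist x z + mdist y w).
    have [k2|k2] := leP (mdist x y + mdist z w) (mdist x w + mdist y z).
      by apply: Or31; exact: bridge_exists.
    apply: Or33; apply: bridge_exists => //;
      rewrite ?(metric_sym w z) ?(metric_sym w y); lra.
  apply: Or32; apply: bridge_exists => //; rewrite ?(metric_sym z y); case: h1; lra.
- by case=> m [n /bridge_fold_dist[]].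
- by case=> m [n /bridge_fold_dist[_ + _]]; rewrite (fold_dist_sym _ z y).
case=> m [n /bridge_fold_dist[_ + _]].
by rewrite (fold_dist_sym _ w z) (fold_dist_sym _ w y) maxC.
Qed.

End FoldTree.

(** * The maps phi_t and psi_t are morphisms *)

Section FoldMorphisms.
Variables (R : realType) (G : groupType) (f : gmor R G) (t : ext_nonneg R).
Variable r : R.
Hypothesis tr : val t = r%:E.
Implicit Types (a b c : gsource f).

Let treeT := gmor_source f.
Let treeY := gmor_target f.
Let morf := @gmor_morph _ _ f.
Let Tt : metricType R := fold_gspace f t.
Let pi : gsource f -> Tt := fold_pi t.
Let psi : Tt -> gtarget f := @fold_induced R G f t.

Lemma mdist_fold_pi a b :
  mdist (fold_pi t a : fold_gspace f t) (fold_pi t b) = fold_dist t a b.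
Proof. exact: fold_mdistE. Qed.

Lemma fold_gspace_rtree : is_rtree (fold_gspace f t).
Proof.
split.
  have -> : [set: fold_gspace f t] = pi @` setT.
    apply/seteqP; split=> // u _; have [a ->] := fold_pi_surj u.
    by exists a.
  apply: connected_continuous_connected; first exact: treeT.1.
  apply: continuous_subspaceT => a; apply/cvg_ballP => e e0.
  apply/nbhs_ballP; exists e => // b; rewrite !ballEmdist /=.
  by apply: le_lt_trans; rewrite mdist_fold_pi; exact: fold_dist_mdist.
move=> u v w z; have [x ->] := fold_pi_surj u; have [y ->] := fold_pi_surj v.
have [x' ->] := fold_pi_surj w; have [y' ->] := fold_pi_surj z.
by rewrite !mdist_fold_pi; exact: fold_dist_hyperbolic tr _ _ _ _.
Qed.

Let treeTt := fold_gspace_rtree.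

Lemma fold_phi_morphism : is_morphism (fold_phi f t).
Proof.
move=> a b; have [s sE isof] := morf a b; exists s => // u us x y ux uy.
rewrite mdist_fold_pi; apply/eqP; rewrite eq_le fold_dist_mdist/=.
by rewrite -(isof u us x y ux uy) mdist_fold_dist.
Qed.

Lemma fold_psi_lipschitz (u v : Tt) : mdist (psi u) (psi v) <= mdist u v.
Proof.
have [a ->] := fold_pi_surj u; have [b ->] := fold_pi_surj v.
by rewrite /psi !fold_inducedE mdist_fold_pi; exact: mdist_fold_dist.
Qed.

Let isometric_on (u : Tt * Tt) :=
  {in segment u.1 u.2 &, forall x y, mdist (psi x) (psi y) = mdist x y}.

Let fold_psi_piece a c : mdist (f a) (f c) = mdist a c -> isometric_on (pi a, pi c).
Proof.
move=> ac; have e : mdist (psi (pi a)) (psi (pi c)) = mdist (pi a) (pi c).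
  rewrite /psi !fold_inducedE mdist_fold_pi; apply/eqP.
  by rewrite eq_le mdist_fold_dist/= ac fold_dist_mdist.
have ord x y := lipschitz_isometric_sub (x := x) (y := y) fold_psi_lipschitz e.
move=> x y; rewrite !inE => acx acy.
have [h|h] := segment_split treeTt acx acy; last exact: ord.
have [acx' ycx] := segment_transl acx h.
by rewrite metric_sym (metric_sym x); exact: ord.
Qed.

Let fold_psi_pieces n a b : pieces f n a b ->
  exists2 s : seq (Tt * Tt), (forall u, u \in s -> isometric_on u) &
    segment (pi a) (pi b) `<=` \bigcup_(u in [set` s]) segment u.1 u.2.
Proof.
elim: n a => [|n IH] a /=.
  move=> ->; exists [:: (pi b, pi b)].
    by move=> u; rewrite inE => /eqP ->; apply: fold_psi_piece; rewrite !mdistxx.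
  by move=> u bu; exists (pi b, pi b); rewrite //= inE.
move=> [c [_ ac /IH[s sP cover]]]; exists ((pi a, pi c) :: s).
  by move=> u; rewrite inE => /predU1P[->|/sP//]; exact: fold_psi_piece.
move=> u /(segment_cover treeTt (pi c))[h|/cover[v vs h]].
  by exists (pi a, pi c); rewrite //= mem_head.
by exists v; rewrite //= inE (vs : v \in s) orbT.
Qed.

(** The images of the pieces of f cover the segment but may stick out of it, whereas [is_morphism]
    asks for equality; [segmentI] trims them, and those disjoint from the segment are dropped. *)
Lemma fold_psi_morphism : is_morphism (fold_psi f t).
Proof.
move=> u v; have [a ->] := fold_pi_surj u; have [b ->] := fold_pi_surj v.
have [n ab] := pieces_exist treeT morf a b.
have [s sP cover] := fold_psi_pieces ab; rewrite -/(pi a) -/(pi b).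
have [s' s'E s'P] : exists2 s' : seq (Tt * Tt),
    segment (pi a) (pi b) `&` \bigcup_(u in [set` s]) segment u.1 u.2 =
      \bigcup_(u in [set` s']) segment u.1 u.2 &
    forall u, u \in s' -> isometric_on u.
  elim: s sP {cover} => [|w s IH] sP.
    exists [::] => //; have -> : [set` [::] : seq (Tt * Tt)] = set0.
      by apply/seteqP; split.
    by rewrite !bigcup_set0 setI0.
  have [|s' s'E s'P] := IH; first by move=> z zs; apply: sP; rewrite inE zs orbT.
  have cons z (s0 : seq (Tt * Tt)) : \bigcup_(u in [set` z :: s0]) segment u.1 u.2 =
      segment z.1 z.2 `|` \bigcup_(u in [set` s0]) segment u.1 u.2.
    apply/seteqP; split=> y => [[p]|[zy|[p ps py]]].
    - by rewrite /= inE => /predU1P[->|ps] py; [left|right; exists p].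
    - by exists z; rewrite //= mem_head.
    - by exists p; rewrite //= inE (ps : p \in s0) orbT.
  rewrite cons setIUr s'E.
  have [[z [abz wz]]|no] := pselect (segment (pi a) (pi b) `&` segment w.1 w.2 !=set0).
    have [p [q pqE]] := segmentI treeTt abz wz.
    exists ((p, q) :: s'); first by rewrite cons pqE.
    move=> y; rewrite inE => /predU1P[->|/s'P//].
    move=> y1 y2; rewrite !inE /= -pqE => -[_ h1] [_ h2].
    by apply: (sP w); rewrite ?mem_head ?inE.
  exists s' => //; rewrite (_ : _ `&` _ = set0) ?set0U//.
  by apply/eqP/negPn/negP => /set0P.
exists s' => //; rewrite -s'E; apply/esym/setIidl; exact: cover.
Qed.

End FoldMorphisms.

Section Maps.
Variables (R : realType) (G : groupType).
Implicit Types (f : gmor R G) (t : ext_nonneg R).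

Lemma level_cases t : val t = +oo%E \/ exists2 r, 0 <= r & val t = r%:E.
Proof.
have : (0 <= val t)%E := set_valP t.
by case: (val t) => [r| |//]; [right; exists r | left].
Qed.

Lemma Phi_gmor f t : [/\ is_rtree (gsource (Phi_map f t)),
  is_rtree (gtarget (Phi_map f t)), range (Phi_map f t) = setT &
  is_morphism (Phi_map f t)].
Proof.
rewrite /Phi_map; case tE: (val t) => [r| |].
- split; [exact: gmor_source|exact: fold_gspace_rtree tE| |].
    by apply/seteqP; split=> // u _; have [a ->] := fold_pi_surj u; exists a.
  exact: fold_phi_morphism.
- by split; [exact: gmor_source|exact: gmor_target|exact: gmor_surj|
    exact: gmor_morph].
- by have : (0 <= val t)%E := set_valP t; rewrite tE.
Qed.

Lemma Psi_gmor f t : [/\ is_rtree (gsource (Psi_map f t)),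
  is_rtree (gtarget (Psi_map f t)), range (Psi_map f t) = setT &
  is_morphism (Psi_map f t)].
Proof.
rewrite /Psi_map; case tE: (val t) => [r| |].
- split; [exact: fold_gspace_rtree tE|exact: gmor_target| |].
    apply/seteqP; split=> // y _; have [a _ <-] : range f y by rewrite gmor_surj.
    by exists (fold_pi t a) => //; exact: fold_inducedE.
  exact: fold_psi_morphism tE.
- split; [exact: gmor_target|exact: gmor_target| |].
    by apply/seteqP; split=> // y _; exists y.
  move=> a b; exists [:: (a, b)] => [|u _ x y _ _ //].
  apply/seteqP; split=> [x h|x [p /=]]; last by rewrite inE => /eqP ->.
  by exists (a, b); rewrite //= inE.
- by have : (0 <= val t)%E := set_valP t; rewrite tE.
Qed.

Definition Phi (ft : gmor R G * ext_nonneg R) : gmor R G :=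
  let H := Phi_gmor ft.1 ft.2 in
  @GMor R G (Phi_map ft.1 ft.2) (let: And4 h _ _ _ := H in h)
    (let: And4 _ h _ _ := H in h) (let: And4 _ _ h _ := H in h)
    (let: And4 _ _ _ h := H in h).

Definition Psi (ft : gmor R G * ext_nonneg R) : gmor R G :=
  let H := Psi_gmor ft.1 ft.2 in
  @GMor R G (Psi_map ft.1 ft.2) (let: And4 h _ _ _ := H in h)
    (let: And4 _ h _ _ := H in h) (let: And4 _ _ h _ := H in h)
    (let: And4 _ _ _ h := H in h).

End Maps.

(** * Continuity *)

Section Stability.
Variables (R : realType) (G : groupType).
Implicit Types (f : gmor R G) (t : ext_nonneg R).

Definition near_isometry f f' (e : R) (S : seq (gsource f))
    (k : gsource f -> gsource f') : Prop :=
  {in S &, forall u v, `|mdist u v - mdist (k u) (k v)| <= e /\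
    `|mdist (f u) (f v) - mdist (f' (k u)) (f' (k v))| <= e}.

Lemma near_isometry_sub f f' e e' S S' (k : gsource f -> gsource f') :
  {subset S' <= S} -> e <= e' ->
  near_isometry e S k -> near_isometry e' S' k.
Proof.
by move=> SS ee h u v /SS uS /SS vS; have [h1 h2] := h u v uS vS;
  split; apply: le_trans ee.
Qed.

Lemma near_isometryP f f' e S (k : gsource f -> gsource f') u v :
    near_isometry e S k -> u \in S -> v \in S ->
  [/\ mdist u v - e <= mdist (k u) (k v), mdist (k u) (k v) <= mdist u v + e,
    mdist (f u) (f v) - e <= mdist (f' (k u)) (f' (k v)) &
    mdist (f' (k u)) (f' (k v)) <= mdist (f u) (f v) + e].
Proof.
move=> h uS vS; have [] := h u v uS vS; rewrite !ler_norml => /andP[? ?] /andP[? ?].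
by split; lra.
Qed.

Section Lower.
Variables (f : gmor R G) (t : ext_nonneg R) (r : R).
Hypothesis tr : val t = r%:E.

Lemma fold_dist_lower a b (e : R) : 0 < e ->
  exists S, exists2 eta : R, 0 < eta &
    forall f' t' (r' : R) (k : gsource f -> gsource f'),
    val t' = r'%:E -> `|r - r'| <= eta -> near_isometry eta [:: a, b & S] k ->
    fold_dist t a b <= fold_dist t' (k a) (k b) + e.
Proof.
move=> e0; have treeT := gmor_source f; have treeY := gmor_target f.
have [W aWb] := fine_chain_exists treeT (@gmor_morph _ _ f) a b (level_ge0 tr).
pose C : R := 2 * 3 ^+ size W; have C1 : 1 <= C.
  by rewrite /C; have : (1 : R) <= 3 ^+ size W by [rewrite exprn_ege1//; lra]; lra.
have C0 : 0 < C by lra.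
exists W, (e / C / 5); first by rewrite !divr_gt0.
set eta := e / C / 5 => f' t' r' k tr' rr' hk.
have treeT' := gmor_source f'.
have eta0 : 0 <= eta by apply: le_trans rr'.
have aS : a \in [:: a, b & W] by rewrite mem_head.
have bS : b \in [:: a, b & W] by rewrite !inE eqxx orbT.
have WS w : w \in W -> w \in [:: a, b & W] by rewrite !inE => ->; rewrite !orbT.
pose L := mdist (k a) (k b).
(* The points k w are only near [k a, k b]. They are moved onto it, by at most 2 eta, keeping the
   distance to the start capped at L, so that their order is preserved. *)
have gP w : exists w', segment (k a) (k b) w' /\ mdist (k a) w' = Num.min (mdist a w) L.
  have [|w' h1 h2] := segment_point (a := k a) (b := k b)
    (r := Num.min (mdist a w) L) treeT'; last by exists w'.
  by rewrite le_min !mdist_ge0 ge_min lexx orbT.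
pose g w := projT1 (cid (gP w)).
have g1 w : segment (k a) (k b) (g w) by rewrite /g; case: cid => ? [].
have g2 w : mdist (k a) (g w) = Num.min (mdist a w) L by rewrite /g; case: cid => ? [].
have [La Lb _ _] := near_isometryP hk aS bS; rewrite -/L in La Lb.
have ga : g a = k a.
  by apply/esym/mdist_eq0_le; rewrite g2 mdistxx ge_min lexx.
have gk w : w \in W -> mdist (g w) (k w) <= 2 * eta.
  move=> wW; have abw := monotone_in (chain_monotone aWb) wW.
  have [_ h1 _ _] := near_isometryP hk aS (WS w wW).
  have [_ h2 _ _] := near_isometryP hk bS (WS w wW).
  have h3 := g2 w; have := g1 w; have := segment_distE treeT' (k w) (g1 w).
  move: abw; rewrite /segment/= -/L (metric_sym b w) in h2 *.
  rewrite (metric_sym (k b) (g w)) => abw h4 h5.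
  have := mdist_ge0 w b; have := mdist_ge0 (g w) (k b).
  by move: h3; have [?|?] := leP (mdist a w) L => *; case: h4; lra.
have chain_g x (V : seq (gsource f)) : segment a b x -> monotone_chain x V b ->
    monotone_chain (g x) (map g V) (k b).
  elim: V x => //= c V IH x abx [xbc _ cb].
  have [abc axc] := segment_trans abx xbc; split=> //; last exact: IH.
  have [h|h] := segment_split treeT' (g1 x) (g1 c) => //.
  move: h axc; have := g1 c; have := g1 x; have := g2 c; have := g2 x.
  rewrite /segment/=; have := mdist_ge0 (g c) (g x); have := mdist_ge0 c x.
  rewrite (metric_sym c x) (metric_sym (g c) (g x)).
  rewrite -/L; have [?|?] := leP (mdist a x) L; have [?|?] := leP (mdist a c) L => *; lra.
have := chain_g a W (segmentl _ _) (chain_monotone aWb); rewrite ga => kaWkb.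
have low := taut_le_fold_dist tr' kaWkb.
rewrite (fold_distE tr aWb).
pose P := [seq (f w, f' (g w)) | w <- W].
have P1 : unzip1 P = map f W by rewrite /unzip1 -map_comp.
have P2 : unzip2 P = map f' (map g W) by rewrite /unzip2 -!map_comp.
have lip := morphism_lipschitz treeT' (@gmor_morph _ _ f').
(* One eta for the near isometry and 2 eta for the displacement of each of the two points. *)
have cl : close_pairs (5 * eta) [:: (f a, f' (k a)), (f b, f' (k b)) & P].
  have inP u : u \in [:: (f a, f' (k a)), (f b, f' (k b)) & P] ->
      exists w, [/\ w \in [:: a, b & W], u.1 = f w & mdist u.2 (f' (k w)) <= 2 * eta].
    rewrite in_cons => /predU1P[->|]; first by exists a; split=> //=; rewrite mdistxx; lra.
    rewrite in_cons => /predU1P[->|]; first by exists b; split=> //=; rewrite mdistxx; lra.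
    move=> /mapP[w wW ->]; exists w; split=> //=; first exact: WS.
    by apply: le_trans (lip _ _) (gk w wW).
  move=> u v /inP[w [wS -> uw]] /inP[z [zS -> vz]].
  have [_ _ h1 h2] := near_isometryP hk wS zS; rewrite ler_norml.
  move: uw vz; tri u.2 v.2 (f' (k w)); tri v.2 (f' (k w)) (f' (k z)).
  by move=> *; apply/andP; split; lra.
have rr5 : `|r - r'| <= 5 * eta by apply: le_trans rr' _; lra.
have := taut_close treeY (gmor_target f') (level_ge0 tr) (level_ge0 tr') rr5 cl.
rewrite P1 P2 size_map ler_norml -/C => /andP[_].
have : (C - 1) * (5 * eta) <= e.
  have -> : 5 * eta = e / C by rewrite /eta; lra.
  by rewrite mulrBl mul1r mulrC divfK ?gt_eqF// gerBl divr_ge0// ltW.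
by lra.
Qed.

End Lower.

End Stability.

(** * Upper semicontinuity of d_t *)

Section Upper.
Variables (R : realType) (G : groupType).
Implicit Types (f : gmor R G) (t s : ext_nonneg R).

Lemma near_isometric_ball (T Y : metricType R) (f : T -> Y) (p q z : T) (c : Y)
    (e B : R) : is_rtree Y -> (forall a b, mdist (f a) (f b) <= mdist a b) ->
  segment p q z -> mdist p q - e <= mdist (f p) (f q) ->
  mdist (f p) c <= B -> mdist (f q) c <= B -> mdist (f z) c <= B + e.
Proof.
move=> treeY lip; rewrite /segment/= => pqz pq pB qB.
have := rtree4 treeY (f z) c (f p) (f q); have := lip p z; have := lip z q.
have := mdist_ge0 p z; have := mdist_ge0 z q.
by rewrite (metric_sym (f z) (f p)) (metric_sym c) (metric_sym c (f p)) => ? ? ? ? []; lra.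
Qed.

(** On a segment between the k-images of consecutive chain points f' is isometric up to 2e, so
    [k y, k x] has image within l + 3e of f'(k x): e from the chain points, 2e from
    [near_isometric_ball]. Then [fold_dist_near] applies. *)
Lemma fold_rel_upper f s (l : R) y x : val s = l%:E -> fold_rel s y x ->
  exists S, forall f' t' (r' e : R) (k : gsource f -> gsource f'),
    val t' = r'%:E -> near_isometry e [:: y, x & S] k -> l + 3 * e <= r' ->
    fold_dist t' (k y) (k x) <= e.
Proof.
move=> sl /(fold_relF sl)[fyx hy].
have treeT := gmor_source f; have morf := @gmor_morph _ _ f.
have [W yWx] := fine_chain_exists treeT morf y x (lexx 0).
exists W => f' t' r' e k tr' hk er.
have treeT' := gmor_source f'; have treeY' := gmor_target f'.
have lip := morphism_lipschitz treeT' (@gmor_morph _ _ f').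
have yS : y \in [:: y, x & W] by rewrite mem_head.
have xS : x \in [:: y, x & W] by rewrite !inE eqxx orbT.
have WS w : w \in W -> w \in [:: y, x & W] by rewrite !inE => ->; rewrite !orbT.
have [_ _ _] := near_isometryP hk yS xS; rewrite fyx mdistxx add0r.
apply: le_trans; apply: (fold_dist_near tr') => z.
have near_x u : u \in [:: y, x & W] -> segment y x u ->
    mdist (f' (k u)) (f' (k x)) <= l + e.
  move=> uS yxu; have [_ _ _] := near_isometryP hk uS xS.
  by have := hy u yxu; rewrite fyx; lra.
move=> yxz; apply: le_trans er; rewrite (_ : l + 3 * e = (l + e) + 2 * e); last by lra.
suff H V u : {subset V <= W} -> u \in [:: y, x & W] -> segment y x u ->
    chain (fine_step f 0) u V x -> forall z, segment (k u) (k x) z ->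
    mdist (f' z) (f' (k x)) <= l + e + 2 * e.
  by apply: (H W y) yxz => //; exact: segmentl.
have one p q z0 : p \in [:: y, x & W] -> q \in [:: y, x & W] ->
    segment y x p -> segment y x q -> mdist (f p) (f q) = mdist p q ->
    segment (k p) (k q) z0 -> mdist (f' z0) (f' (k x)) <= l + e + 2 * e.
  move=> pS qS yxp yxq pq pqz.
  apply: (near_isometric_ball treeY' lip pqz); try exact: near_x.
  by have [_ ? ? _] := near_isometryP hk pS qS; lra.
elim: V u => [|c V IH] u VW uS yxu /=.
  by move=> [ux _] z0; apply: one => //; exact: segmentr.
move=> [uxc [uc _] cx] z0 /(segment_cover treeT' (k c)).
have cS : c \in [:: y, x & W] by apply/WS/VW; rewrite mem_head.
have [yxc _] := segment_trans yxu uxc.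
case; first exact: one.
by apply: IH => // v vV; apply: VW; rewrite inE vV orbT.
Qed.

(** A subdivision with n moves has n + 1 jumps, and each of them contributes an error of at most
    e. *)
Lemma subdivision_upper f s (l : R) a b p : val s = l%:E -> subdivision s a p b ->
  exists S, forall f' t' (r' e : R) (k : gsource f -> gsource f'),
    val t' = r'%:E -> 0 <= e -> near_isometry e [:: a, b & S] k -> l + 3 * e <= r' ->
    fold_dist t' (k a) (k b) <= subdivision_length p + (2 * size p + 1)%:R * e.
Proof.
move=> sl; elim: p a => [|[x y] p IH] a /=.
  move=> /(fold_rel_upper sl)[S hS]; exists S => f' t' r' e k tr' e0 hk er.
  by rewrite /subdivision_length big_nil add0r mul1r; exact: hS tr' hk er.
move=> [/(fold_rel_upper sl)[S1 h1] /IH[S2 h2]]; exists [:: x, y & S1 ++ S2].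
move=> f' t' r' e k tr' e0 hk er.
have sub1 : {subset [:: a, x & S1] <= [:: a, b, x, y & S1 ++ S2]}.
  by move=> u; rewrite !inE mem_cat => /or3P[->|->|->]; rewrite ?orbT.
have sub2 : {subset [:: y, b & S2] <= [:: a, b, x, y & S1 ++ S2]}.
  by move=> u; rewrite !inE mem_cat => /or3P[->|->|->]; rewrite ?orbT.
have := h1 f' t' r' e k tr' (near_isometry_sub sub1 (lexx _) hk) er.
have := h2 f' t' r' e k tr' e0 (near_isometry_sub sub2 (lexx _) hk) er.
have xS : x \in [:: a, b, x, y & S1 ++ S2] by rewrite !inE eqxx !orbT.
have yS : y \in [:: a, b, x, y & S1 ++ S2] by rewrite !inE eqxx !orbT.
have [_ + _ _] := near_isometryP hk xS yS.
rewrite /subdivision_length big_cons /= -/(subdivision_length p).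
have := fold_dist_triangle t' (k x) (k a) (k b).
have := fold_dist_triangle t' (k y) (k x) (k b).
have := fold_dist_mdist t' (k x) (k y).
move=> i1 i2 i3 i4 i5 i6.
have -> : (2 * (size p).+1 + 1)%:R = (2 * size p + 1)%:R + 2 :> R.
  by rewrite -natrD; congr _%:R; lia.
by lra.
Qed.

Lemma fold_dist_level f t (r : R) a b (e : R) : val t = r%:E -> 0 < r -> 0 < e ->
  exists s, exists2 l, val s = l%:E /\ l < r &
    fold_dist (f := f) s a b <= fold_dist t a b + e.
Proof.
move=> tr r0 e0; have treeT := gmor_source f; have treeY := gmor_target f.
have r20 : 0 <= r / 2 by lra.
(* Steps of length at most r / 2 are fine for every level from r / 2 on, so one chain serves both
   radii r and r - d. *)
have [W aWb] := fine_chain_exists treeT (@gmor_morph _ _ f) a b r20.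
pose C : R := 2 * 3 ^+ size W; have C1 : 1 <= C.
  by rewrite /C; have : (1 : R) <= 3 ^+ size W by [rewrite exprn_ege1//; lra]; lra.
have C0 : 0 < C by lra.
pose d := Num.min (r / 2) (e / C).
have d0 : 0 < d by rewrite lt_min divr_gt0//= divr_gt0.
have dr : d <= r / 2 by rewrite ge_min lexx.
have de : d <= e / C by rewrite ge_min lexx orbT.
have rd0 : (0 <= (r - d)%:E)%E by rewrite lee_fin; lra.
pose s : ext_nonneg R := exist _ (r - d)%:E (mem_set rd0).
have sl : val s = (r - d)%:E by [].
exists s, (r - d); first by split=> //; lra.
have fine (l : R) : r / 2 <= l -> chain (fine_step f l) a W b.
  have st x y : r / 2 <= l -> fine_step f (r / 2) x y -> fine_step f l x y.
    by move=> rl [xy [?|?]]; split=> //; [lra|right; lra].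
  move=> rl; elim: W a aWb {C C1 C0 d d0 dr de rd0 s sl} => [|c W IH] u /=; first exact: st.
  by move=> [h1 h2 /IH h3]; split=> //; exact: st.
rewrite (fold_distE sl (fine _ _)); last by lra.
rewrite (fold_distE tr (fine _ _)); last by lra.
pose P := [seq (f w, f w) | w <- W].
have P1 : unzip1 P = map f W by rewrite /unzip1 -map_comp.
have P2 : unzip2 P = map f W by rewrite /unzip2 -map_comp.
have cl : close_pairs d [:: (f a, f a), (f b, f b) & P].
  have inP u : u \in [:: (f a, f a), (f b, f b) & P] -> u.1 = u.2.
    by rewrite !inE => /or3P[/eqP->|/eqP->|/mapP[w _ ->]].
  by move=> u v /inP -> /inP ->; rewrite subrr normr0 ltW.
have rr : `|r - (r - d)| <= d by rewrite opprB addrCA subrr addr0 ger0_norm// ltW.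
have := taut_close treeY treeY (level_ge0 tr) (level_ge0 sl) rr cl.
rewrite P1 P2 size_map ler_norml -/C => /andP[+ _].
have : (C - 1) * d <= e.
  rewrite (le_trans (_ : _ <= C * d)) ?ler_pM2r ?gerBl//.
  by rewrite mulrC -ler_pdivlMr.
lra.
Qed.

Lemma fold_dist_upper f t (r : R) a b (e : R) : val t = r%:E -> 0 < e ->
  exists S, exists2 eta : R, 0 < eta &
    forall f' t' (r' : R) (k : gsource f -> gsource f'),
    val t' = r'%:E -> `|r - r'| <= eta -> near_isometry eta [:: a, b & S] k ->
    fold_dist t' (k a) (k b) <= fold_dist t a b + e.
Proof.
move=> tr e0; have := level_ge0 tr; rewrite le_eqVlt => /predU1P[r0|r0].
  have [W aWb] := fine_chain_exists (gmor_source f) (@gmor_morph _ _ f) a b (level_ge0 tr).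
  exists [::], e => // f' t' r' k tr' _ hk.
  rewrite (fold_distE tr aWb) -r0 (taut0_chain (gmor_target f) aWb).
  apply: le_trans (fold_dist_mdist _ _ _) _.
  have bS : b \in [:: a; b] by rewrite !inE eqxx orbT.
  by have [] := near_isometryP hk (mem_head _ _) bS.
have e20 : 0 < e / 2 by rewrite divr_gt0.
have [s [l [sl lr] hs]] := fold_dist_level a b tr r0 e20.
have e40 : 0 < e / 4 by rewrite divr_gt0.
have [p abp pl] := fold_dist_adherent s a b e40.
have [S hS] := subdivision_upper sl abp.
pose n : R := (2 * size p + 1)%:R; have n0 : 0 < n by rewrite ltr0n addn1.
(* The first bound makes the gap r - l absorb 3 eta and |r - r'|; the second limits the transport
   error to e / 4, next to e / 2 for the change of level and e / 4 for the choice of p. *)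
exists S, (Num.min ((r - l) / 4) (e / 4 / n)).
  by rewrite lt_min !divr_gt0//= subr_gt0.
set eta := Num.min _ _ => f' t' r' k tr' rr hk.
have eta1 : eta <= (r - l) / 4 by rewrite ge_min lexx.
have eta2 : eta <= e / 4 / n by rewrite ge_min lexx orbT.
have eta0 : 0 <= eta by apply: le_trans rr.
have er : l + 3 * eta <= r' by move: rr; rewrite ler_norml => /andP[]; lra.
have := hS f' t' r' eta k tr' eta0 hk er; rewrite -/n.
have : n * eta <= e / 4 by rewrite mulrC -ler_pdivlMr.
lra.
Qed.

End Upper.

(** * From stable pseudo-distances to continuous maps *)

Section Continuity.
Variables (R : realType) (G : groupType).
Implicit Types (f : gmor R G) (t : ext_nonneg R).

Definition level_dist f t (a b : gsource f) : R :=
  if val t is +oo%E then mdist (f a) (f b) else fold_dist t a b.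

Definition stable (D : forall f t, gsource f -> gsource f -> R) : Prop :=
  forall f t (a b : gsource f) (e : R), 0 < e ->
  exists (S : seq (gsource f)) (eta : R) (N : set (ext_nonneg R)),
    [/\ 0 < eta, nbhs t N & forall f' t' (k : gsource f -> gsource f'),
      N t' -> near_isometry eta [:: a, b & S] k ->
      `|D f t a b - D f' t' (k a) (k b)| <= e].

Lemma nbhs_level t (U : set (\bar R)) : nbhs (val t) U -> nbhs t [set s | U (val s)].
Proof. by move=> tU; apply: (@initial_continuous _ _ val t). Qed.

Lemma level_dist_stable : stable level_dist.
Proof.
move=> f t a b e e0; have [too|[r _ tr]] := level_cases t.
  (* As eta <= 1, d(k a, k b) <= M < t', so f' maps [k a, k b] within t' of f'(k b) and d_t' agrees
     exactly with d_oo there. *)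
  pose eta := Num.min 1 e; pose M := mdist a b + 1.
  exists [::], eta, [set s | (M%:E < val s)%E]; split.
  - by rewrite lt_min ltr01.
  - apply: (@nbhs_level t [set x | (M%:E < x)%E]); rewrite too; exists M; split=> //; exact: num_real.
  - move=> f' t' k /= Mt' hk; rewrite /level_dist too.
    have bS : b \in [:: a; b] by rewrite !inE eqxx orbT.
    have [ab1 ab2] := hk a b (mem_head _ _) bS.
    have ee : eta <= e by rewrite ge_min lexx orbT.
    have e1 : eta <= 1 by rewrite ge_min lexx.
    suff -> : (if val t' is +oo%E then mdist (f' (k a)) (f' (k b))
      else fold_dist t' (k a) (k b)) = mdist (f' (k a)) (f' (k b)) by exact: le_trans ee.
    have [->//|[r' _ tr']] := level_cases t'; rewrite tr'.
    apply/eqP; rewrite eq_le mdist_fold_dist andbT; apply: (fold_dist_near tr') => z kz.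
    have := morphism_lipschitz (gmor_source f') (@gmor_morph _ _ f') z (k b).
    move: ab1 kz Mt'; rewrite ler_norml tr' lte_fin /M /segment/= => /andP[? ?].
    by have := mdist_ge0 (k a) z; lra.
have [S1 [h1 h10 H1]] := fold_dist_lower tr a b e0.
have [S2 [h2 h20 H2]] := fold_dist_upper a b tr e0.
pose eta := Num.min h1 h2; have eta0 : 0 < eta by rewrite lt_min h10.
have eta1 : eta <= h1 by rewrite ge_min lexx.
have eta2 : eta <= h2 by rewrite ge_min lexx orbT.
exists (S1 ++ S2), eta, [set s | exists2 l, val s = l%:E & `|r - l| < eta]; split=> //.
  apply: (@nbhs_level t [set x | exists2 l, x = l%:E & `|r - l| < eta]).
  rewrite tr; apply: (@filterS _ (nbhs r) _ (ball r eta)); last exact: nbhsx_ballx.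
  by move=> l rl; exists l.
move=> f' t' k [r' tr' rr'] hk; rewrite /level_dist tr tr'.
have k1 : near_isometry h1 [:: a, b & S1] k.
  apply: near_isometry_sub eta1 hk => u.
  by rewrite !inE mem_cat => /or3P[->|->|->]; rewrite ?orbT.
have k2 : near_isometry h2 [:: a, b & S2] k.
  apply: near_isometry_sub eta2 hk => u.
  by rewrite !inE mem_cat => /or3P[->|->|->]; rewrite ?orbT.
have := H1 f' t' r' k tr' (le_trans (ltW rr') eta1) k1.
have := H2 f' t' r' k tr' (le_trans (ltW rr') eta2) k2.
by rewrite ler_norml => ? ?; apply/andP; split; lra.
Qed.

Lemma source_dist_stable : stable (fun f _ a b => mdist a b).
Proof.
move=> f t a b e e0; exists [::], e, setT; split=> //; first exact: filterT.
move=> f' t' k _ hk.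
by have [] := hk a b (mem_head _ _) (_ : b \in [:: a; b]); rewrite // !inE eqxx orbT.
Qed.

Lemma target_dist_stable : stable (fun f _ a b => mdist (f a) (f b)).
Proof.
move=> f t a b e e0; exists [::], e, setT; split=> //; first exact: filterT.
move=> f' t' k _ hk.
by have [] := hk a b (mem_head _ _) (_ : b \in [:: a; b]); rewrite // !inE eqxx orbT.
Qed.

(* [gmor_ball] for maps that are defined on the whole source. *)
Definition near_equivariant f f' (e : R) (S : set (gsource f)) (A : set G)
    (h : gsource f -> gsource f') : Prop :=
  forall x y g, S x -> S y -> A g ->
    `|mdist x (gact g y) - mdist (h x) (gact g (h y))| < e /\
    `|mdist (f x) (f (gact g y)) - mdist (f' (h x)) (f' (gact g (h y)))| < e.

Lemma near_equivariant_sub f f' (e e' : R) S S' A A' (h : gsource f -> gsource f') :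
  S' `<=` S -> A' `<=` A -> e <= e' ->
  near_equivariant e S A h -> near_equivariant e' S' A' h.
Proof.
move=> SS AA ee H x y g /SS Sx /SS Sy /AA Ag; have [h1 h2] := H x y g Sx Sy Ag.
by split; apply: lt_le_trans ee.
Qed.

Section Equivariant.
Variable D : forall f t, gsource f -> gsource f -> R.
Hypothesis stableD : stable D.
Hypothesis D_ge0 : forall f t a b, 0 <= @D f t a b.
Hypothesis D_le : forall f t a b, @D f t a b <= mdist a b.

Let goodfor f t (X : set (gsource f * gsource f * G)) (e : R) :=
  exists (S : set (gsource f)) (A : set G) (eta : R) (N : set (ext_nonneg R)),
    [/\ finite_set S, finite_set A, 0 < eta, nbhs t N &
      forall f' t' (h : gsource f -> gsource f'), N t' -> near_equivariant eta S A h ->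
      forall u, X u -> `|@D f t u.1.1 (gact u.2 u.1.2) -
        @D f' t' (h u.1.1) (gact u.2 (h u.1.2))| < e].

(** The point g y joins the finite set and is sent to g (h y); the group element 1 controls
    distances among the old points, g those to the new one. *)
Let stable_one f t x y g (e : R) : 0 < e -> goodfor t [set (x : gsource f, y, g)] e.
Proof.
move=> e0; have e20 : 0 < e / 2 by rewrite divr_gt0.
have [S [eta [N [eta0 tN H]]]] := stableD t x (gact g y) e20.
exists [set` [:: x, y & S]], [set 1%g; g], (Num.min eta (e / 2)), N.
set d := Num.min _ _; have d1 : d <= eta by rewrite ge_min lexx.
have d2 : d <= e / 2 by rewrite ge_min lexx orbT.
split=> //; first by rewrite lt_min eta0.
move=> f' t' h Nt' hh _ -> /=.
have xS : x \in [:: x, y & S] by rewrite mem_head.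
have yS : y \in [:: x, y & S] by rewrite !inE eqxx orbT.
have hhg u v (uS : u \in _) (vS : v \in _) := hh u v g uS vS (or_intror erefl).
have hh1 u v (uS : u \in _) (vS : v \in _) := hh u v 1%g uS vS (or_introl erefl).
(* If x = g y, the images h x and g (h y) may differ; but D vanishes at (x, x), and its value for f'
   is at most d(h x, g (h y)), which is small. *)
have [xgy|xgy] := eqVneq x (gact g y).
  have [+ _] := hhg x y xS yS; rewrite -xgy mdistxx.
  have -> : @D f t x x = 0.
    by apply/eqP; rewrite eq_le D_ge0 andbT -(mdistxx x) D_le.
  rewrite !sub0r !normrN !ger0_norm ?mdist_ge0//.
  by have := @D_le f' t' (h x) (gact g (h y)); lra.
pose k u := if u == gact g y then gact g (h y) else h u.
have kP u : u \in [:: x, gact g y & S] ->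
    (u \in [:: x, y & S]) && (u != gact g y) \/ u = gact g y.
  have [->|ugy] := eqVneq u (gact g y); first by right.
  by rewrite !inE (negPf ugy) /= => /orP[->|->]; left; rewrite ?orbT.
have hk : near_isometry eta [:: x, gact g y & S] k.
  have mixed u : (u \in [:: x, y & S]) && (u != gact g y) ->
      `|mdist u (gact g y) - mdist (h u) (gact g (h y))| <= eta /\
      `|mdist (f u) (f (gact g y)) - mdist (f' (h u)) (f' (gact g (h y)))| <= eta.
    by move=> /andP[uS _]; have [? ?] := hhg u y uS yS; split; lra.
  move=> u v /kP[uP|->] /kP[vP|->]; rewrite /k ?eqxx.
  - case/andP: uP => uS /negPf ->; case/andP: vP => vS /negPf ->.
    by have := hh1 u v uS vS; rewrite !gact1 => -[? ?]; split; lra.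
  - by have := mixed u uP; case/andP: uP => _ /negPf ->.
  - rewrite (metric_sym (gact g y)) (metric_sym (f (gact g y))).
    rewrite (metric_sym (gact g (h y))) (metric_sym (f' (gact g (h y)))).
    by have := mixed v vP; case/andP: vP => _ /negPf ->.
  - by rewrite !mdistxx subrr normr0; split; lra.
have := H f' t' k Nt' hk; rewrite /k eqxx (negPf xgy); lra.
Qed.

Let stable_seq f t (s : seq (gsource f * gsource f * G)) (e : R) : 0 < e ->
  goodfor t [set` s] e.
Proof.
move=> e0; elim: s => [|[[x y] g] s [S1 [A1 [d1 [N1 [fS1 fA1 d10 tN1 H1]]]]]].
  by exists set0, set0, 1, setT; split=> //; exact: filterT.
have [S2 [A2 [d2 [N2 [fS2 fA2 d20 tN2 H2]]]]] := stable_one t x y g e0.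
exists (S1 `|` S2), (A1 `|` A2), (Num.min d1 d2), (N1 `&` N2); split.
- by rewrite finite_setU.
- by rewrite finite_setU.
- by rewrite lt_min d10.
- exact: filterI.
move=> f' t' h [Nt1 Nt2] hh u /=; rewrite inE => /predU1P[->|us].
  apply: H2 => //; apply: near_equivariant_sub hh; [exact: subsetUr|exact: subsetUr|].
  by rewrite ge_min lexx orbT.
apply: H1 => //; apply: near_equivariant_sub hh; [exact: subsetUl|exact: subsetUl|].
by rewrite ge_min lexx.
Qed.

Lemma stable_equivariant f t (X : set (gsource f)) (A : set G) (e : R) :
  finite_set X -> finite_set A -> 0 < e ->
  exists (S : set (gsource f)) (B : set G) (eta : R) (N : set (ext_nonneg R)),
    [/\ finite_set S, finite_set B, 0 < eta, nbhs t N &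
      forall f' t' (h : gsource f -> gsource f'), N t' -> near_equivariant eta S B h ->
      forall x y g, X x -> X y -> A g ->
      `|@D f t x (gact g y) - @D f' t' (h x) (gact g (h y))| < e].
Proof.
move=> fX fA e0.
have [s sE] : exists s : seq (gsource f * gsource f * G), X `*` X `*` A = [set` s].
  by apply/finite_seqP; do 2?apply: finite_setX.
have [S [B [eta [N [fS fB eta0 tN H]]]]] := stable_seq t s e0.
exists S, B, eta, N; split=> // f' t' h Nt' hh x y g Xx Xy Ag.
by apply: (H f' t' h Nt' hh (x, y, g)); rewrite -sE.
Qed.

End Equivariant.

(** The map c presents the source of Th(f, t) as a quotient of T_0. A finite set in that source is
    lifted by a section l of c, and an approximation h of the lifted points in T'_0 induces c' o
    h. *)
Lemma stable_continuous (Th : gmor R G * ext_nonneg R -> gmor R G)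
    (D1 D2 : forall f, ext_nonneg R -> gsource f -> gsource f -> R) :
  stable D1 -> stable D2 ->
  (forall f t a b, 0 <= D1 f t a b <= mdist a b) ->
  (forall f t a b, 0 <= D2 f t a b <= mdist a b) ->
  (forall f t, exists c : gsource f -> gsource (Th (f, t)),
    [/\ forall u, exists a, u = c a,
      forall g a, c (gact g a) = gact g (c a),
      forall a b, mdist (c a) (c b) = D1 f t a b &
      forall a b, mdist (Th (f, t) (c a)) (Th (f, t) (c b)) = D2 f t a b]) ->
  continuous Th.
Proof.
move=> st1 st2 b1 b2 coord [f t] U [X [A [e [fX fA e0 XU]]]].
have [c [cS cJ c1 c2]] := coord f t.
pose l u := projT1 (cid (cS u)).
have cl u : c (l u) = u by rewrite /l; case: cid.
have flX : finite_set (l @` X) by exact: finite_image.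
have D10 f' t' a b : 0 <= D1 f' t' a b by case/andP: (b1 f' t' a b).
have D1m f' t' a b : D1 f' t' a b <= mdist a b by case/andP: (b1 f' t' a b).
have D20 f' t' a b : 0 <= D2 f' t' a b by case/andP: (b2 f' t' a b).
have D2m f' t' a b : D2 f' t' a b <= mdist a b by case/andP: (b2 f' t' a b).
have [S1 [B1 [d1 [N1 [fS1 fB1 d10 tN1 H1]]]]] :=
  stable_equivariant st1 D10 D1m t flX fA e0.
have [S2 [B2 [d2 [N2 [fS2 fB2 d20 tN2 H2]]]]] :=
  stable_equivariant st2 D20 D2m t flX fA e0.
pose Y := l @` X `|` (S1 `|` S2).
exists (gmor_ball Y (B1 `|` B2) (Num.min d1 d2), N1 `&` N2).
  split; last exact: filterI.
  exists Y, (B1 `|` B2), (Num.min d1 d2); split=> //.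
  - by rewrite !finite_setU.
  - by rewrite finite_setU.
  - by rewrite lt_min d10.
move=> [f' t'] [/= [h hP] [Nt1 Nt2]]; apply: XU.
have [c' [_ cJ' c1' c2']] := coord f' t'.
have lY u : X u -> l u \in Y by move=> Xu; apply/mem_set; left; exists u.
pose h' (x : X) := h (exist _ (l (val x)) (lY _ (set_valP x))).
exists (c' \o h') => x y g Ag.
(* Outside Y the value is arbitrary; h' x is a point at hand. *)
pose H u := if pselect (u \in Y) is left p then h (exist _ u p) else h' x.
have HE u (p : u \in Y) : H u = h (exist _ u p).
  rewrite /H; case: pselect => // q; congr h; exact: eq_exist.
have hH : near_equivariant (Num.min d1 d2) Y (B1 `|` B2) H.
  move=> u v g' Yu Yv Bg; rewrite (HE _ (mem_set Yu)) (HE _ (mem_set Yv)).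
  exact: (hP (exist _ u (mem_set Yu)) (exist _ v (mem_set Yv))).
have Hl z : H (l (val z)) = h' z by exact: HE.
have lX z : X z -> (l @` X) (l z) by exists z.
have := set_valP x; have := set_valP y => /lX Xy /lX Xx; split.
  rewrite /= -(cl (val x)) -(cl (val y)) -cJ -cJ' c1 c1' -!Hl.
  apply: (H1 f' t' H Nt1 _ _ _ g Xx Xy Ag); apply: near_equivariant_sub hH.
  - by move=> z S1z; right; left.
  - exact: subsetUl.
  - by rewrite ge_min lexx.
rewrite /= -(cl (val x)) -(cl (val y)) -cJ -cJ' c2 c2' -!Hl.
apply: (H2 f' t' H Nt2 _ _ _ g Xx Xy Ag); apply: near_equivariant_sub hH.
- by move=> z S2z; right; right.
- exact: subsetUr.
- by rewrite ge_min lexx orbT.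
Qed.

Lemma level_dist_bounds f t a b : 0 <= level_dist (f := f) t a b <= mdist a b.
Proof.
rewrite /level_dist; case: (val t) => [r| |];
  rewrite ?fold_dist_ge0 ?fold_dist_mdist//.
by rewrite mdist_ge0 (morphism_lipschitz (gmor_source f) (@gmor_morph _ _ f)).
Qed.

Lemma mdist_bounds f (a b : gsource f) : 0 <= mdist a b <= mdist a b.
Proof. by rewrite mdist_ge0 lexx. Qed.

Lemma target_dist_bounds f a b : 0 <= mdist (f a) (f b) <= mdist a b.
Proof.
by rewrite mdist_ge0 (morphism_lipschitz (gmor_source f) (@gmor_morph _ _ f)).
Qed.

Lemma Phi_map_coord f t : exists c : gsource f -> gsource (Phi_map f t),
  [/\ forall u, exists a, u = c a,
    forall g a, c (gact g a) = gact g (c a),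
    forall a b, mdist (c a) (c b) = mdist a b &
    forall a b, mdist (Phi_map f t (c a)) (Phi_map f t (c b)) = level_dist t a b].
Proof.
rewrite /Phi_map /level_dist; case: (val t) => [r| |];
  exists id; split=> //;
  by first [by move=> u; exists u|move=> a b; exact: mdist_fold_pi].
Qed.

Lemma Psi_map_coord f t : exists c : gsource f -> gsource (Psi_map f t),
  [/\ forall u, exists a, u = c a,
    forall g a, c (gact g a) = gact g (c a),
    forall a b, mdist (c a) (c b) = level_dist t a b &
    forall a b, mdist (Psi_map f t (c a)) (Psi_map f t (c b)) = mdist (f a) (f b)].
Proof.
have fold : exists c : gsource f -> gsource (fold_psi f t),
    [/\ forall u, exists a, u = c a,
      forall g a, c (gact g a) = gact g (c a),
      forall a b, mdist (c a) (c b) = fold_dist t a b &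
      forall a b, mdist (fold_psi f t (c a)) (fold_psi f t (c b)) =
        mdist (f a) (f b)].
  exists (fold_pi t); split=> [u|g a|a b|a b].
  - exact: fold_pi_surj.
  - exact/esym/fold_actE.
  - exact: mdist_fold_pi.
  - by rewrite /= !fold_inducedE.
rewrite /Psi_map /level_dist; case: (val t) => [r| |] //.
exists f; split=> //; last exact: gfunJ.
by move=> u; have [a _ <-] : range f u by [rewrite gmor_surj]; exists a.
Qed.

Lemma Phi_continuous : continuous (@Phi R G).
Proof.
apply: (stable_continuous source_dist_stable level_dist_stable).
- by move=> f _; exact: mdist_bounds.
- exact: level_dist_bounds.
- exact: Phi_map_coord.
Qed.

Lemma Psi_continuous : continuous (@Psi R G).
Proof.
apply: (stable_continuous level_dist_stable target_dist_stable).
- exact: level_dist_bounds.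
- by move=> f _; exact: target_dist_bounds.
- exact: Psi_map_coord.
Qed.

End Continuity.

Theorem proposition3p4 (R : realType) (G : groupType) :
  exists Phi Psi : gmor R G * ext_nonneg R -> gmor R G,
    [/\ forall (f : gmor R G) (t : ext_nonneg R),
          gmor_map (Phi (f, t)) = Phi_map f t,
        forall (f : gmor R G) (t : ext_nonneg R),
          gmor_map (Psi (f, t)) = Psi_map f t,
        continuous Phi &
        continuous Psi].
Proof.
exists (@Phi R G), (@Psi R G).
by split; [| |exact: Phi_continuous|exact: Psi_continuous].
Qed.
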